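(* Let $X$ be a separable Banach space such that $X^*$ has a weak$^*$ unconditional asymptotic structure. Then the following properties are equivalent. (1) $S_Z(X)\le\omega$. (2) $X^*$ admits an equivalent AUC$^*$ norm. (3) $X^*$ admits an equivalent AMUC$^*$ norm. (4) $X^*$ does not satisfy property $( * )$.
   Context: Szlenk index. For a weak$^*$-compact $K\subset X^*$ and $\varepsilon>0$, let $s_\varepsilon(K)$ be $K$ minus the union of all (relatively) weak$^*$-open subsets $V$ of $K$ with $\operatorname{diam}V\le\varepsilon$. Put $s^1_\varepsilon(K)=s_\varepsilon(K)$, $s^{\alpha+1}_\varepsilon(K)=s_\varepsilon(s^\alpha_\varepsilon(K))$, and $s^\alpha_\varepsilon(K)=\bigcap_{\beta<\alpha}s^\beta_\varepsilon(K)$ for limit $\alpha$. Let $S_Z(K,\varepsilon)$ be the least $\alpha$ with $s^\alpha_\varepsilon(K)=\emptyset$ if it exists and $\infty$ otherwise, and $S_Z(X)=\sup_{\varepsilon>0}S_Z(B_{X^*},\varepsilon)$, $B_{X^*}$ being the closed unit ball of $X^*$. $\omega$ is the first infinite ordinal. Let $\mathrm{cof}_{w^*}(X^* )$ be the set of weak$^*$-closed subspaces of $X^*$ of finite codimension; $S_Y$ denotes the unit sphere of $Y$. Weak$^*$ unconditional asymptotic structure: there is $C\ge1$ such that for every $n\ge1$: $\exists X_1\in\mathrm{cof}_{w^*}(X^* )\ \forall x_1^*\in S_{X_1}\ \cdots\ \exists X_n\in\mathrm{cof}_{w^*}(X^* )\ \forall x_n^*\in S_{X_n}$: $(x_i^*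 )_{i=1}^n$ is $C$-unconditional, i.e. $\|\sum\epsilon_ia_ix_i^*\|\le C\|\sum a_ix_i^*\|$ for all scalars $a_i$ and signs $\epsilon_i$. A norm on $X^*$ is AUC$^*$ if for all $t>0$, $\inf_{x^*\in S_{X^*}}\sup_{Y\in\mathrm{cof}_{w^*}(X^* )}\inf_{y^*\in S_Y}(\|x^*+ty^*\|-1)>0$, and AMUC$^*$ if for all $t>0$, $\inf_{x^*\in S_{X^*}}\sup_{Y\in\mathrm{cof}_{w^*}(X^* )}\inf_{y^*\in S_Y}(\max\{\|x^*+ty^*\|,\|x^*-ty^*\|\}-1)>0$ (with $\inf\emptyset=+\infty$; the spheres are those of the norm in question). Let $T_n=\{\emptyset\}\cup\bigcup_{k=1}^n\mathbb N^k$; $|s|$ is the length of $s$, and $s_{|i}$ its initial segment of length $i$. For $t=(t_1,\dots,t_m)$ and $k\in\mathbb N$, $(t,k)$ denotes the sequence $(t_1,\dots,t_m,k)$ obtained by appending $k$ to $t$ (so $(\emptyset,k)=(k)$). A family $(x_s^* )_{s\in T_n}\subset X^*$ is weak$^*$-null if $w^*\text{-}\lim_k x^*_{(t,k)}=0$ for every $t\in T_{n-1}$ (where $T_0=\{\emptyset\}$). Property $( * )$: there is $\varepsilon>0$ such that for all $n\ge1$ there is a weak$^*$-null family $(x_s^* )_{s\in T_n}\subset X^*$ with $x_\emptyset^*\in B_{X^*}$, $\|x_s^*\|\ge\varepsilon$ for all $s\ne\emptyset$, and $x_\emptyset^*+\sum_{i=1}^n\varepsilon_ix^*_{s_{|i}}\in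 B_{X^*}$ for all $s\in T_n$ with $|s|=n$ and all $\varepsilon_1,\dots,\varepsilon_n\in\{-1,1\}$. *)

(* Defs.v *)
From HB Require Import structures.
From mathcomp Require Import all_boot all_order all_algebra.
From mathcomp Require Import all_classical all_reals all_analysis.

Set Implicit Arguments.
Unset Strict Implicit.
Unset Printing Implicit Defensive.

Import Order.TTheory GRing.Theory Num.Theory.
Import numFieldNormedType.Exports.

Local Open Scope classical_set_scope.
Local Open Scope ring_scope.

Section Separable.
Context (T : topologicalType).

Definition separable_space : Prop := exists D : set T, countable D /\ dense D.

End Separable.

Section Dual.
Context (R : realType) (X : normedModType R).

Definition cont_linear : {pred X -> R^o} :=
  [pred f | `[< linear f /\ continuous f >]].

Record dual := Dual {
  dual_fun :> X -> R^o ;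
  dual_funP : dual_fun \in cont_linear }.

HB.instance Definition _ := [isSub of dual for dual_fun].
HB.instance Definition _ := [Choice of dual by <:].

Lemma cont_linear_submod : submod_closed cont_linear.
Proof.
split=> [|a f g /asboolP[lf cf] /asboolP[lg cg]]; apply/asboolP; split.
- by move=> a x y /=; rewrite /GRing.zero/= addr0 scaler0.
- exact: cst_continuous.
- move=> b x y; rewrite !fctE lf lg !scalerDr !scalerA (mulrC a b).
  by rewrite addrACA.
- by move=> x; exact: cvgD (cvgM (cvg_cst a) (cf x)) (cg x).
Qed.

HB.instance Definition _ :=
  GRing.isSubmodClosed.Build R _ cont_linear cont_linear_submod.
HB.instance Definition _ := [SubChoice_isSubLmodule of dual by <:].

Lemma dual_linear (f : dual) : linear f.
Proof. by case: f => f /= /asboolP[]. Qed.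

Lemma dual_continuous (f : dual) : continuous f.
Proof. by case: f => f /= /asboolP[]. Qed.

HB.instance Definition _ (f : dual) :=
  GRing.isLinear.Build R X R^o *:%R f (dual_linear f).

Definition dual_norm (f : dual) : R := sup [set `|f x| | x in [set x | `|x| <= 1]].

Lemma dual_norm_has_sup (f : dual) :
  has_sup [set `|f x| | x in [set x | `|x| <= 1]].
Proof.
split; first by exists `|f 0|, 0 => //=; rewrite normr0.
have /linear_bounded_continuous/bounded_funP/(_ 1)[M fM] := @dual_continuous f.
by exists M => _ [x /= x1 <-]; exact: fM.
Qed.

Lemma dual_norm_ub (f : dual) x : `|x| <= 1 -> `|f x| <= dual_norm f.
Proof.
move=> x1; apply: ub_le_sup; last by exists x.
by have [] := dual_norm_has_sup f.
Qed.

Lemma dual_norm_le (f : dual) M :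
  (forall x, `|x| <= 1 -> `|f x| <= M) -> dual_norm f <= M.
Proof.
move=> fM; apply: ge_sup; first by have [] := dual_norm_has_sup f.
by move=> _ [x /= x1 <-]; exact: fM.
Qed.

Lemma dual_normD (f g : dual) : dual_norm (f + g) <= dual_norm f + dual_norm g.
Proof.
apply: dual_norm_le => x x1; apply: (le_trans (ler_normD (f x) (g x))).
by apply: lerD; exact: dual_norm_ub.
Qed.

Lemma dual_normZ_le a (f : dual) : dual_norm (a *: f) <= `|a| * dual_norm f.
Proof.
apply: dual_norm_le => x x1; rewrite [X in `|X|](_ : _ = a * f x)// normrM.
by apply: ler_wpM2l => //; exact: dual_norm_ub.
Qed.

Lemma dual_normZ a (f : dual) : dual_norm (a *: f) = `|a| * dual_norm f.
Proof.
apply/eqP; rewrite eq_le dual_normZ_le/=.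
have n0 (g : dual) : 0 <= dual_norm g.
  by apply: (le_trans _ (@dual_norm_ub g 0 _)); rewrite ?normr0.
have [->|a0] := eqVneq a 0; first by rewrite normr0 mul0r.
rewrite -ler_pdivlMl ?normr_gt0//.
by rewrite -normfV (le_trans _ (dual_normZ_le _ _))// scalerA mulVf// scale1r.
Qed.

Lemma dual_norm0_eq0 (f : dual) : dual_norm f = 0 -> f = 0.
Proof.
move=> f0; apply/val_inj/funext => x /=.
have [->|x0] := eqVneq x 0; first by rewrite linear0.
have nx0 : `|x| != 0 by rewrite normr_eq0.
have : `|f (`|x|^-1 *: x)| <= 0.
  by rewrite -f0 dual_norm_ub// normrZ normfV normr_id mulVf.
rewrite normr_le0 linearZ/= => /eqP/(congr1 ( *%R `|x|)).
by rewrite mulr0 [X in X = _](mulrA `|x|) divff// mul1r.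
Qed.

HB.instance Definition _ :=
  Lmodule_isNormed.Build R dual dual_normD dual_normZ dual_norm0_eq0.

(* The same carrier as [dual], with the topology of pointwise convergence
   instead of the norm topology. *)
Definition weak_star := initial_topology (fun f : dual => f : {ptws X -> R^o}).
HB.instance Definition _ := Topological.on weak_star.

Lemma weak_star_cvgP (u : nat -> dual) (f : dual) :
  (fun k => u k : weak_star) @ \oo --> (f : weak_star) <->
  forall x, (fun k => u k x : R^o) @ \oo --> (f x : R^o).
Proof.
have ev_cont : continuous
    ((fun g : dual => g : {ptws X -> R^o}) : weak_star -> {ptws X -> R^o}).
  exact: initial_continuous.
split=> [uf x|uf A [_ [[B oB <-] Bf BA]]].
  have uf' := cvg_comp _ _ uf (ev_cont f).
  exact: (cvg_comp _ _ uf' (@proj_continuous _ (fun=> R^o) x _)).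
have nB : nbhs (f : {ptws X -> R^o}) B by exact: open_nbhs_nbhs.
have pw : {ptws, ((fun k => u k : X -> R^o) @ \oo) --> (f : X -> R^o)}.
  by apply/pointwise_cvgP => x; exact: uf.
have := pw _ nB; rewrite !nbhs_filterE /= => h.
by apply: filterS h => k uB; exact: BA.
Qed.

Definition dual_ball : set dual := [set f | `|f| <= 1].

End Dual.

Section Ordinals.

(* Ordinals as well-founded trees. [olim f] denotes the least upper bound of
   the family [f]; it is 0 when [I] is empty and may be attained, so only
   [ole], and not Leibniz equality, compares ordinals. Lemma
   [szlenk_iter_limit] recovers the usual clause for limit ordinals. *)
Inductive ord : Type :=
| ozero : ord
| osucc : ord -> ord
| olim (I : Type) (f : I -> ord) : ord.

(* [olt_of (ole a) b] is [a < b]. *)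
Fixpoint olt_of (le_a : ord -> Prop) (b : ord) : Prop :=
  match b with
  | ozero => False
  | osucc b' => le_a b'
  | olim J f => exists i, olt_of le_a (f i)
  end.

Fixpoint ole (a b : ord) : Prop :=
  match a with
  | ozero => True
  | osucc a' => olt_of (ole a') b
  | olim J f => forall i, ole (f i) b
  end.

Definition olt (a b : ord) : Prop := olt_of (ole a) b.

Definition omega : ord := olim (fun n : nat => iter n osucc ozero).

(* Values in the ordinals together with the symbol infinity ([None]). *)
Definition xole (a b : option ord) : Prop :=
  match a, b with
  | _, None => True
  | None, Some _ => False
  | Some a, Some b => ole a b
  end.

Definition is_least (P : ord -> Prop) (a : ord) : Prop :=
  P a /\ forall b, P b -> ole a b.

Definition least_ord (P : ord -> Prop) : option ord :=
  match pselect (exists a, is_least P a) with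
  | left h => Some (projT1 (cid h))
  | right _ => None
  end.

Definition xosup (I : Type) (f : I -> option ord) : option ord :=
  if `[< forall i, f i <> None >]
  then Some (olim (fun i => odflt ozero (f i)))
  else None.

Lemma olt_of_mono (P Q : ord -> Prop) b :
  (forall c, P c -> Q c) -> olt_of P b -> olt_of Q b.
Proof.
by move=> PQ; elim: b => //= [b _|J f IH [j]]; [exact: PQ|move=> /IH; exists j].
Qed.

Lemma ole_trans a b c : ole a b -> ole b c -> ole a c.
Proof.
elim: a b c => [//|a IHa|J f IH] b c /=; last by move=> ab bc j; exact: IH bc.
elim: b c => [//|b IHb|J f IHb] c /=.
- by move=> ab; apply: olt_of_mono => d; exact: IHa.
- by move=> [j aj] /(_ j); exact: IHb.
Qed.

Lemma ole_lim J (f : J -> ord) j a : ole a (f j) -> ole a (olim f).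
Proof.
by elim: a => [//|a _|L g IH] /=; [move=> ?; exists j|move=> gf l; exact: IH].
Qed.

Lemma ole_refl a : ole a a.
Proof. by elim: a => //= J f IH j; exact: ole_lim (IH j). Qed.

Lemma ole_succ a b : ole a b -> ole a (osucc b).
Proof.
elim: a b => [//|a IHa|J f IH] b /=; last by move=> ab j; exact: IH.
by elim: b => [//|b _|J f IHb] /=; [exact: IHa|move=> [j /IHb]; exact: ole_lim].
Qed.

Lemma oltW a b : olt a b -> ole a b.
Proof.
by elim: b => [//|b _|J f IHb] /=; [exact: ole_succ|move=> [j /IHb]; exact: ole_lim].
Qed.

Lemma ole_or_olt a b : ole a b \/ olt b a.
Proof.
elim: a b => [|a IHa|J f IH] b; first by left.
- elim: b => [|b _|J f IHb]; [by right|exact: IHa|].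
  have [[j ajl]|nolt] := EM (exists j, olt a (f j)); first by left; exists j.
  by right => j; case: (IHb j) => // ?; case: nolt; exists j.
- have [[j bj]|nolt] := EM (exists j, olt b (f j)); first by right; exists j.
  by left => j; case: (IH j b) => // ?; case: nolt; exists j.
Qed.

Lemma olt_wf : well_founded olt.
Proof.
suff H a b : ole b a -> Acc olt b by move=> a; apply: H (ole_refl a).
elim: a b => [|a IHa|J f IH] b ba; constructor => c cb.
- by have := ole_trans (a := osucc c) cb ba.
- by apply: IHa; exact: (ole_trans (a := osucc c) cb ba).
- have [j cj] := ole_trans (a := osucc c) cb ba.
  by apply: (IH j); exact: oltW.
Qed.

Lemma oltxx a : ~ olt a a.
Proof. by elim: (olt_wf a) => b _ IH bb; exact: (IH b bb bb). Qed.

Lemma is_least_ex (P : ord -> Prop) a : P a -> exists b, is_least P b.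
Proof.
elim: (olt_wf a) => b _ IH Pb.
have [[c cb Pc]|nP] := EM (exists2 c, olt c b & P c); first exact: IH Pc.
exists b; split=> // c Pc; case: (ole_or_olt b c) => // cb.
by case: nP; exists c.
Qed.

End Ordinals.

Section Szlenk.
Context (R : realType) (X : normedModType R).
Implicit Types (K V : set (dual X)) (eps : R).

Definition diam (V : set (dual X)) : \bar R :=
  ereal_sup [set `|p.1 - p.2|%:E | p in V `*` V].

Definition rel_wopen (K V : set (dual X)) : Prop :=
  exists2 U : set (weak_star X), open U & V = K `&` U.

Definition szlenk_deriv eps K : set (dual X) :=
  K `\` \bigcup_(V in [set V | rel_wopen K V /\ (diam V <= eps%:E)%E]) V.

(* The intersection with [K] only matters for an empty family. *)
Fixpoint szlenk_iter eps K (a : ord) : set (dual X) :=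
  match a with
  | ozero => K
  | osucc b => szlenk_deriv eps (szlenk_iter eps K b)
  | olim J f => K `&` \bigcap_(i in [set: J]) szlenk_iter eps K (f i)
  end.

Lemma szlenk_deriv_sub eps K : szlenk_deriv eps K `<=` K.
Proof. by move=> f []. Qed.

Lemma szlenk_deriv_mono eps K L :
  K `<=` L -> szlenk_deriv eps K `<=` szlenk_deriv eps L.
Proof.
move=> KL f [Kf nf]; split; first exact: KL.
move=> [V [[U oU VE] dV] Vf]; apply: nf; exists (K `&` U); last first.
  by split=> //; move: Vf; rewrite VE => -[].
split; first by exists U.
apply: le_trans dV; apply: ereal_sup_le => _ [[g h] [/= [Kg Ug] [Kh Uh]] <-].
by exists (g, h) => //; rewrite VE; do ![split => //=]; exact: KL.
Qed.

Lemma szlenk_iter_sub eps K a : szlenk_iter eps K a `<=` K.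
Proof.
elim: a => [//|a IH|J f _] /=; last by move=> f' [].
exact: subset_trans (@szlenk_deriv_sub _ _) IH.
Qed.

Lemma szlenk_iter_anti eps K a b :
  ole a b -> szlenk_iter eps K b `<=` szlenk_iter eps K a.
Proof.
elim: a b => [|a IHa|J f IH] b.
- by move=> _; exact: szlenk_iter_sub.
- elim: b => [//|b _ ab|J f IHb [j aj]] /=.
  + by apply: szlenk_deriv_mono; exact: IHa.
  + by move=> g [_ /(_ j Logic.I)]; exact: IHb.
- move=> ab g bg; split; first exact: szlenk_iter_sub bg.
  by move=> j _; exact: (IH j b).
Qed.

Lemma szlenk_iter_limit eps K a : olt ozero a ->
  (forall b, olt b a -> olt (osucc b) a) ->
  szlenk_iter eps K a = [set g | forall b, olt b a -> szlenk_iter eps K b g].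
Proof.
move=> a0 alim; apply/seteqP; split=> [g ag b /oltW ba|].
  exact: szlenk_iter_anti ag.
elim: a a0 alim => [//|a _ _|J f IH a0 alim g ag].
  by move=> /(_ a (ole_refl a)) /oltxx.
split; first by case: a0 => j j0; exact: (ag ozero (ex_intro _ j j0)).
move=> j _; have [fa|af] := ole_or_olt (osucc (f j)) (olim f).
  exact: ag.
have le b : olt b (olim f) -> olt b (f j).
  by move=> bf; exact: (ole_trans (a := osucc b) bf).
have ge b : olt b (f j) -> olt b (olim f) by exists j.
apply: IH => [|b /ge/alim/le//|b /ge]; first exact: le.
exact: ag.
Qed.

Definition szlenk_at K eps : option ord :=
  least_ord (fun a => szlenk_iter eps K a = set0).

Definition szlenk_index : option ord :=
  xosup (fun eps : {posnum R} => szlenk_at (@dual_ball R X) eps%:num).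

End Szlenk.

Section Asymptotic.
Context (R : realType) (X : normedModType R).
Local Notation X' := (dual X).

Definition subspace_set (Y : set X') : Prop :=
  Y 0 /\ forall (a : R) (f g : X'), Y f -> Y g -> Y (a *: f + g).

Definition finite_codim (Y : set X') : Prop :=
  exists (n : nat) (e : 'I_n -> X'), forall f : X',
    exists a : 'I_n -> R, Y (f - \sum_(i < n) a i *: e i).

Definition cof_wstar : set (set X') :=
  [set Y | [/\ subspace_set Y, closed (Y : set (weak_star X)) & finite_codim Y]].

Definition sphere_of (N : X' -> R) (Y : set X') : set X' :=
  Y `&` [set f | N f = 1].

Definition unconditional (C : R) (s : seq X') : Prop :=
  forall (a : nat -> R) (b : nat -> bool),
    `|\sum_(i < size s) ((-1) ^+ b i * a i) *: s`_i|
      <= C * `|\sum_(i < size s) a i *: s`_i|.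

(* [asymptotic_game P n s]: with the vectors [s] already played, the player
   choosing subspaces can force [P] after [n] more rounds. *)
Fixpoint asymptotic_game (P : seq X' -> Prop) (n : nat) (s : seq X') : Prop :=
  match n with
  | 0%N => P s
  | n'.+1 => exists2 Y, cof_wstar Y &
      forall f, sphere_of Num.norm Y f -> asymptotic_game P n' (rcons s f)
  end.

Definition wstar_unconditional_structure : Prop :=
  exists2 C : R, 1 <= C &
    forall n : nat, (1 <= n)%N -> asymptotic_game (unconditional C) n [::].

Definition is_norm (N : X' -> R) : Prop :=
  [/\ forall f g, N (f + g) <= N f + N g,
      forall (a : R) f, N (a *: f) = `|a| * N f &
      forall f, N f = 0 -> f = 0].

Definition equivalent_norm (N : X' -> R) : Prop :=
  is_norm N /\
  exists c C : R, [/\ 0 < c, 0 < C & forall f, c * `|f| <= N f <= C * `|f|].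

Definition AUCstar (N : X' -> R) : Prop :=
  forall t : R, 0 < t ->
    (0 < ereal_inf [set
           ereal_sup [set
             ereal_inf [set (N (x + t *: y) - 1)%:E
               | y in sphere_of N Y]
             | Y in cof_wstar]
           | x in sphere_of N setT])%E.

Definition AMUCstar (N : X' -> R) : Prop :=
  forall t : R, 0 < t ->
    (0 < ereal_inf [set
           ereal_sup [set
             ereal_inf [set (Num.max (N (x + t *: y)) (N (x - t *: y)) - 1)%:E
               | y in sphere_of N Y]
             | Y in cof_wstar]
           | x in sphere_of N setT])%E.

(* A family indexed by the tree of sequences of length at most [n] is a function
   on all of [seq nat] whose values on longer sequences are never used. The
   cast on the limit selects the weak* rather than the norm neighbourhoods. *)
Definition wstar_null (n : nat) (x : seq nat -> X') : Prop :=
  forall t : seq nat, (size t < n)%N ->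
    (fun k : nat => x (rcons t k) : weak_star X) @ \oo --> ((0 : X') : weak_star X).

Definition property_star : Prop :=
  exists2 eps : R, 0 < eps & forall n : nat, (1 <= n)%N ->
    exists x : seq nat -> X',
      [/\ wstar_null n x,
          dual_ball (x [::]),
          forall s, s <> [::] -> (size s <= n)%N -> eps <= `|x s| &
          forall (s : seq nat) (b : nat -> bool), size s = n ->
            dual_ball (x [::] + \sum_(1 <= i < n.+1) (-1) ^+ b i *: x (take i s))].

End Asymptotic.

(* Main.v *)
From HB Require Import structures.
Require Import Defs.
From mathcomp Require Import all_boot all_order all_algebra finmap.
From mathcomp Require Import all_classical all_reals all_analysis.
From mathcomp Require Import lra ring.

Set Implicit Arguments.
Unset Strict Implicit.
Unset Printing Implicit Defensive.

Import Order.TTheory GRing.Theory Num.Theory.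
Import numFieldNormedType.Exports.

Local Open Scope classical_set_scope.
Local Open Scope ring_scope.

(** Three implications need an argument; an AUC* norm is AMUC* by definition.

    From an AMUC* norm to the failure of the sign tree property
    ([AMUCstar_no_star]). A weak* null sequence approaches every weak* closed
    subspace of finite codimension in norm ([cof_approx]). So, climbing a tree
    with vectors bounded away from 0, one can at each step choose a child and a
    sign that increase the AMUC* norm of the partial sum by a fixed amount, and
    the sums along tall trees are not bounded.

    From the failure of the sign tree property to Szlenk index at most omega
    ([szlenk_le_omega_of_no_star]). If no finite iterate of a derivation of the
    ball is empty, a point of the [n]-th iterate is the root of a tree of
    weak* convergent sequences of height [n], whose increments are bounded away
    from 0 and whose sums along branches are bounded ([szlenk_tree]). The
    subspaces chosen in the game of the unconditional structure can be followed
    up to small errors by passing to tails, so the branches are almost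
    unconditional, and all signed sums are bounded as well.

    From Szlenk index at most omega to an AUC* norm ([szlenk_AUCstar]). This is
    a duality argument which does not go through convex hulls of derived
    sets. Charge each [u] in the dual ball for the derived sets that it has left,
    for countably many thresholds with summable coefficients. The resulting
    weight [W], with values in [[1, 2]], is weak* lower semicontinuous, and
    increases by a fixed amount when [u] moves by more than [eps] in norm but
    stays weak* close to its old position ([weight_jump]). Let [A] be the set of [x]
    in [X] with [`|u x| <= W u] for all [u] in the dual ball. If [x] is in [A]
    and [z] is small and almost annihilated by finitely many suitable
    functionals, then [x + z] is in [(1 + o(`|z|)) A], because a change of
    [u z] is only possible for [u] that move far in norm, for which the bound
    [W u] is larger ([polar_perturb]). Thus [A] is the unit ball of an
    asymptotically uniformly smooth norm on [X], and its support function is the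
    dual norm, which is AUC*. *)

(** * The weak* topology of a dual space *)

Section WeakStar.
Context (R : realType) (X : normedModType R).
Local Notation X' := (dual X).
Implicit Types (f g : X') (x : X).

Lemma dualD f g x : (f + g) x = f x + g x. Proof. by []. Qed.

Lemma dualN f x : (- f) x = - f x. Proof. by []. Qed.

Lemma dualB f g x : (f - g) x = f x - g x. Proof. by []. Qed.

Lemma dualZ (a : R) f x : (a *: f) x = a * f x. Proof. by []. Qed.

Lemma dual0 x : (0 : X') x = 0. Proof. by []. Qed.

Lemma dual_appB f x y : f (x - y) = f x - f y. Proof. exact: linearB. Qed.

Lemma dual_appD f x y : f (x + y) = f x + f y. Proof. exact: linearD. Qed.

Lemma dual_appZ f (a : R) x : f (a *: x) = a * f x. Proof. exact: linearZ. Qed.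

Lemma dual_appN f x : f (- x) = - f x. Proof. exact: linearN. Qed.

Lemma dual_norm_mul f x : `|f x| <= `|f| * `|x|.
Proof.
have [->|x0] := eqVneq x 0; first by rewrite linear0 !normr0 mulr0.
have nx : 0 < `|x| by rewrite normr_gt0.
rewrite -ler_pdivrMr// -[X in _ / X]normr_id -normf_div mulrC -dual_appZ.
by apply: dual_norm_ub; rewrite normrZ normfV normr_id mulVf ?gt_eqF.
Qed.

Lemma dual_norm_half f : exists2 x, `|x| <= 1 & `|f| / 2 <= f x.
Proof.
have [f0|f0] := eqVneq f 0; first by exists 0; rewrite ?f0 normr0 ?mul0r//.
have nf : 0 < `|f| by rewrite normr_gt0.
have [_ [x /= x1 <-] fx] :
    exists2 y, [set `|f x| | x in [set x | `|x| <= 1]] y & `|f| - `|f| / 2 < y.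
  by apply: sup_adherent; [lra|exact: dual_norm_has_sup].
have [fx0|fx0] := lerP 0 (f x).
  by exists x => //; move: fx; rewrite ger0_norm//; lra.
by exists (- x); rewrite ?normrN// dual_appN; move: fx; rewrite ltr0_norm//; lra.
Qed.

Lemma eval_continuous x : continuous ((fun f => f x) : weak_star X -> R^o).
Proof.
have ev : continuous
    ((fun g : X' => g : {ptws X -> R^o}) : weak_star X -> {ptws X -> R^o}).
  exact: initial_continuous.
move=> f.
exact: (@cvg_comp _ _ _ _ _ _ _ _ (ev f) (@proj_continuous _ (fun=> R^o) x f)).
Qed.

Lemma eval_near f x (e : R) : 0 < e ->
  exists U : set (weak_star X),
    [/\ open U, U f & forall g, U g -> `|g x - f x| < e].
Proof.
move=> e0; exists ((fun g : X' => g x : R^o) @^-1` ball (f x : R^o) e); split.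
- by apply: open_comp; [move=> g _; exact: eval_continuous|exact: ball_open].
- exact: ballxx.
- by move=> g; rewrite /ball/= distrC.
Qed.

Lemma closed_eval0 x : closed ([set f | f x = 0] : set (weak_star X)).
Proof.
refine (@preimage_closed _ _ (fun g : weak_star X => (g : X') x : R^o) [set 0] _ _).
  by move=> g _; exact: eval_continuous.
exact: closed_eq.
Qed.

Lemma cvg_linear_defect (T : Type) (F : set_system T) {FF : Filter F}
    (u v w : T -> R^o) (a : R) (lu lv lw : R^o) :
  u @ F --> lu -> v @ F --> lv -> w @ F --> lw ->
  (fun t => u t - (a * v t + w t)) @ F --> lu - (a * lv + lw).
Proof. by move=> cu cv cw; exact: (cvgB cu (cvgD (cvgM (cvg_cst a) cv) cw)). Qed.

(** Banach-Alaoglu: the ball is cut out, inside the product of the compact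
    intervals of radius [`|x|], by closed linearity conditions. *)
Lemma dual_ball_compact : compact (@dual_ball R X : set (weak_star X)).
Proof.
pose ev : weak_star X -> {ptws X -> R^o} := fun f => (f : X') : X -> R^o.
pose K : set {ptws X -> R^o} := [set h | forall x, `[- `|x|, `|x|]%classic (h x)].
have cK : compact K.
  refine (@tychonoff X (fun=> R^o) (fun x => `[- `|x|, `|x|]%classic) _) => x.
  exact: segment_compact.
pose L : set {ptws X -> R^o} := [set h | linear h].
have cL : closed L.
  have -> : L = \bigcap_(p in [set: R * X * X])
      ((fun h : {ptws X -> R^o} =>
          (h (p.1.1 *: p.1.2 + p.2) - (p.1.1 * h p.1.2 + h p.2)) : R^o)
        @^-1` [set 0]).
    apply/seteqP; split=> [h lh [[a x] y] _ /=|h lh a x y].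
      by rewrite lh subrr.
    by apply/eqP; rewrite -subr_eq0; apply/eqP; exact: (lh (a, x, y) Logic.I).
  apply: closed_bigI => -[[a x] y] _; refine (preimage_closed _ _); last exact: closed_eq.
  move=> h _; have pc z : (fun h' : {ptws X -> R^o} => h' z : R^o) @ h --> (h z : R^o).
    exact: (@proj_continuous _ (fun=> R^o) z h).
  exact: (cvg_linear_defect (pc (a *: x + y)) (pc x) (pc y)).
move=> F PF FB.
have FK : (ev @ F) K.
  rewrite nbhs_filterE /=; apply: filterS FB => f /= f1 x.
  rewrite /= in_itv/= -ler_norml; apply: (le_trans (dual_norm_mul f x)).
  by rewrite -[leRHS]mul1r ler_wpM2r.
have [h [Kh Fh]] := cK _ _ FK.
have Lh : linear h.
  have FL : (ev @ F) L by apply: (@filterE _ F) => f; exact: dual_linear.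
  by apply: cL => B Bh; exact: (Fh L B FL Bh).
have h1 x : `|x| <= 1 -> `|h x| <= 1.
  by move=> x1; apply: le_trans x1; move: (Kh x); rewrite /= in_itv/= -ler_norml.
have hC : h \in @cont_linear R X.
  apply/asboolP; split=> //.
  pose hl : {linear X -> R^o} := HB.pack (h : X -> R^o) (GRing.isLinear.Build R X R^o *:%R h Lh).
  apply: (linear_bounded_continuous hl).1; apply/bounded_funP => r; exists r => x.
  by apply: le_trans; move: (Kh x); rewrite /= in_itv/= -ler_norml.
exists (Dual hC); split.
  by apply: dual_norm_le.
move=> A B FA [_ [[W oW <-] Wh WB]].
have [g [[f Af fg] Og]] : (ev @` A) `&` W !=set0.
  apply: Fh; last by apply: open_nbhs_nbhs.
  by rewrite nbhs_filterE /=; apply: filterS FA => f Af; exists f.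
by exists f; split=> //; apply: WB; rewrite /= -/(ev f) fg.
Qed.

Lemma dual_ball_closed : closed (@dual_ball R X : set (weak_star X)).
Proof.
have -> : (@dual_ball R X : set (weak_star X)) =
    \bigcap_(x in [set x : X | `|x| <= 1])
      ((fun g : weak_star X => (g : X') x : R^o) @^-1` [set r | `|r| <= 1]).
  apply/seteqP; split=> [f /= f1 x /= x1|f /= fx].
    by apply: (le_trans (dual_norm_ub f x1)).
  by apply: dual_norm_le => x x1; exact: fx.
apply: closed_bigI => x _; refine (preimage_closed _ _).
  by move=> g _; exact: eval_continuous.
have -> : [set r : R^o | `|r| <= 1] = [set` `[-1, 1]].
  by apply/seteqP; split=> r /=; rewrite in_itv/= ler_norml.
exact: itv_closed.
Qed.

HB.instance Definition _ := isPointed.Build (weak_star X) (0 : X').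

Lemma dual_ball_cover (U : X' -> set (weak_star X)) :
  (forall f, dual_ball f -> open (U f) /\ U f f) ->
  exists2 s : seq X', (forall f, f \in s -> dual_ball f) &
    forall g, dual_ball g -> exists2 f, f \in s & U f g.
Proof.
move=> oU; have := @dual_ball_compact; rewrite compact_cover.
move=> /(_ X' (@dual_ball R X) U (fun f fB => (oU f fB).1)).
have cU : @dual_ball R X `<=` cover (@dual_ball R X) U by move=> f fB; exists f; [|exact: (oU f fB).2].
move=> /(_ cU)[D DB Dc]; exists (enum_fset D).
  by move=> f fD; have := DB f fD; rewrite inE.
by move=> g /Dc[f fD Ufg]; exists f.
Qed.

End WeakStar.

(** * Weak* null sequences and subspaces of finite codimension *)

Section FiniteCodim.
Context (R : realType) (X : normedModType R).
Local Notation X' := (dual X).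
Implicit Types (f e : X') (x : X) (Y : set X').

Lemma real_cvgP (u : nat -> R^o) (l : R^o) :
  u @ \oo --> l <-> forall d : R, 0 < d ->
    exists K, forall k, (K <= k)%N -> `|u k - l| < d.
Proof.
split=> [/cvgrPdist_lt uf d d0|ul].
  have [K _ Kk] := uf d d0; exists K => k Kle.
  by rewrite distrC; exact: Kk.
apply/cvgrPdist_lt => d d0; have [K Kk] := ul d d0.
by exists K => // k /= Kle; rewrite distrC; exact: Kk.
Qed.

Definition wnull (v : nat -> X') : Prop :=
  (fun k => v k : weak_star X) @ \oo --> ((0 : X') : weak_star X).

Lemma wnullP (v : nat -> X') :
  wnull v <-> forall x (d : R), 0 < d ->
    exists K, forall k, (K <= k)%N -> `|v k x| < d.
Proof.
split=> [/weak_star_cvgP vx x d d0|vx].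
  have [K Kk] := (real_cvgP _ _).1 (vx x) d d0.
  by exists K => k /Kk; rewrite dual0 subr0.
apply/weak_star_cvgP => x; apply/real_cvgP => d d0.
by have [K Kk] := vx x d d0; exists K => k /Kk; rewrite dual0 subr0.
Qed.

Definition wseq_closed Y : Prop :=
  forall (u : nat -> X') f, (forall k, Y (u k)) -> wnull (fun k => u k - f) -> Y f.

Lemma wnull_cvg (u : nat -> X') f : wnull (fun k => u k - f) ->
  (fun k => u k : weak_star X) @ \oo --> (f : weak_star X).
Proof.
move=> /wnullP uf; apply/weak_star_cvgP => x; apply/real_cvgP => d d0.
exact: uf.
Qed.

Lemma closed_wseq Y : closed (Y : set (weak_star X)) -> wseq_closed Y.
Proof.
move=> cY u f uY /wnull_cvg uf.
refine (@closed_cvg nat (weak_star X) \oo _ (fun k => u k : weak_star X)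
  Y cY _ f uf).
exact: nearW.
Qed.

Lemma subspaceD Y f g : subspace_set Y -> Y f -> Y g -> Y (f + g).
Proof. by move=> [_ YZ] Yf Yg; rewrite -[f]scale1r; exact: YZ. Qed.

Lemma subspaceZ Y a f : subspace_set Y -> Y f -> Y (a *: f).
Proof. by move=> [Y0 YZ] Yf; rewrite -[_ *: _]addr0; exact: YZ. Qed.

Lemma subspaceB Y f g : subspace_set Y -> Y f -> Y g -> Y (f - g).
Proof.
by move=> sY Yf Yg; rewrite -scaleN1r; apply: subspaceD => //; exact: subspaceZ.
Qed.

(** If the coefficients stayed away from 0, dividing by them would exhibit [e0]
    as a weak* limit of elements of [Y]. *)
Lemma line_coef_to0 Y e0 (g : nat -> X') (b : nat -> R) :
  subspace_set Y -> wseq_closed Y -> ~ Y e0 -> wnull g ->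
  (forall k, Y (g k - b k *: e0)) ->
  forall d : R, 0 < d -> exists K, forall k, (K <= k)%N -> `|b k| < d.
Proof.
move=> sY cY e0Y /wnullP g0 gY d d0; apply: contrapT => nK.
have /choice[h hP] : forall K, exists k, (K <= k)%N /\ d <= `|b k|.
  move=> K; apply: contrapT => nk; apply: nK; exists K => k Kk.
  by rewrite ltNge; apply/negP => bk; apply: nk; exists k.
have bn0 K : b (h K) != 0 by rewrite -normr_gt0 (lt_le_trans d0)// (hP K).2.
apply: e0Y; apply: (cY (fun K => e0 - (b (h K))^-1 *: g (h K))).
  move=> K; have := subspaceZ (- (b (h K))^-1) sY (gY (h K)).
  by rewrite scalerBr scalerA mulNr mulVf// scaleN1r opprK scaleNr addrC.
apply/wnullP => x r r0; have [K Kk] := g0 x (r * d) (mulr_gt0 r0 d0).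
exists K => k Kle; rewrite addrAC subrr add0r dualN dualZ normrN normrM normfV.
rewrite ltr_pdivrMl ?normr_gt0// mulrC.
apply: lt_le_trans (Kk _ (leq_trans Kle (hP k).1)) _.
by rewrite ler_pM2l// (hP k).2.
Qed.

Definition add_line Y e0 : set X' := [set f | exists a : R, Y (f - a *: e0)].

Lemma add_line_subspace Y e0 : subspace_set Y -> subspace_set (add_line Y e0).
Proof.
move=> sY; split; first by exists 0; rewrite scale0r subr0; exact: sY.1.
move=> a f g [b Yf] [c Yg]; exists (a * b + c).
have := sY.2 a _ _ Yf Yg.
by rewrite scalerBr scalerA scalerDl opprD addrACA.
Qed.

(** The coefficients along [e0] of a weak* convergent sequence are Cauchy, by
    [line_coef_to0] applied to differences. *)
Lemma add_line_closed Y e0 : subspace_set Y -> wseq_closed Y -> ~ Y e0 ->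
  wseq_closed (add_line Y e0).
Proof.
move=> sY cY e0Y u f /choice[a uY] uf; have /wnullP uf' := uf.
have acvg : cvg ((a : nat -> R^o) @ \oo).
  apply/cauchy_cvgP/cauchy_exP => d d0; apply: contrapT => nd.
  have /choice[h hP] : forall K, exists k, (K <= k)%N /\ d <= `|a k - a K|.
    move=> K; apply: contrapT => nk; apply: nd; exists (a K); exists K => // k /= Kk.
    rewrite /ball/= distrC ltNge; apply/negP => ak; apply: nk; exists k.
    by [].
  have g0 : wnull (fun K => u (h K) - u K).
    apply/wnullP => x r r0; have r2 : 0 < r / 2 by lra.
    have [K Kk] := uf' x _ r2; exists K => k Kle.
    have h1 := Kk _ (leq_trans Kle (hP k).1); have h2 := Kk _ Kle.
    rewrite !dualB in h1 h2 *.
    have -> : u (h k) x - u k x = (u (h k) x - f x) - (u k x - f x) by lra.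
    by apply: (le_lt_trans (ler_normB _ _)); lra.
  have gY K : Y ((u (h K) - u K) - (a (h K) - a K) *: e0).
    have := subspaceB sY (uY (h K)) (uY K).
    by rewrite scalerBl !opprD !opprK addrACA.
  have [K /(_ K (leqnn K))] := line_coef_to0 sY cY e0Y g0 gY d0.
  by rewrite ltNge (hP K).2.
pose l : R := lim (a @ \oo); exists l; apply: (cY (fun k => u k - a k *: e0) _ uY).
have /real_cvgP al : (a : nat -> R^o) @ \oo --> (l : R^o) by [].
apply/wnullP => x d d0; have d2 : 0 < d / 2 by lra.
have e1 : 0 < `|e0 x| + 1 by rewrite ltr_pwDr.
have [K1 h1] := uf' x _ d2.
have [K2 h2] := al (d / 2 / (`|e0 x| + 1)) (divr_gt0 d2 e1).
exists (maxn K1 K2) => k; rewrite geq_max => /andP[/h1 {}h1 /h2 {}h2].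
rewrite !dualB !dualZ in h1 *.
have -> : u k x - a k * e0 x - (f x - l * e0 x)
    = (u k x - f x) - (a k - l) * e0 x by lra.
have h3 : `|(a k - l) * e0 x| <= d / 2.
  rewrite normrM; move: h2; rewrite ltr_pdivlMr// => /ltW; apply: le_trans.
  by rewrite ler_wpM2l// lerDl.
by apply: (le_lt_trans (ler_normB _ _)); lra.
Qed.

(** Induction on the codimension. Adding a line to [Y] lowers it by one, and the
    coefficients along this line tend to 0, so they can be dropped. *)
Lemma codim_approx (n : nat) Y (e : 'I_n -> X') (v : nat -> X') :
  subspace_set Y -> wseq_closed Y ->
  (forall f, exists a : 'I_n -> R, Y (f - \sum_(i < n) a i *: e i)) ->
  wnull v ->
  exists u : nat -> X', (forall k, Y (u k)) /\
    forall d : R, 0 < d -> exists K, forall k, (K <= k)%N -> `|v k - u k| < d.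
Proof.
elim: n Y e => [|n IH] Y e sY cY Ye v0.
  exists v; split=> [k|d d0]; last by exists 0%N => k _; rewrite subrr normr0.
  by have [a] := Ye (v k); rewrite big_ord0 subr0.
have [Ye0|Ye0] := EM (Y (e ord0)).
  apply: (IH Y (fun i => e (lift ord0 i))) => // f.
  have [a] := Ye f; rewrite big_ord_recl opprD addrCA => Ya.
  exists (fun i => a (lift ord0 i)); have := subspaceD sY (subspaceZ (a ord0) sY Ye0) Ya.
  by rewrite addNKr.
have := IH (add_line Y (e ord0)) (fun i => e (lift ord0 i)).
case=> //.
- exact: add_line_subspace.
- exact: add_line_closed.
- move=> f; have [a] := Ye f; rewrite big_ord_recl => Ya.
  exists (fun i => a (lift ord0 i)); exists (a ord0).
  by move: Ya; rewrite opprD addrA addrAC.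
move=> u [/choice[b uY] uv]; exists (fun k => u k - b k *: e ord0); split=> // d d0.
have u0 : wnull u.
  apply/wnullP => x r r0; have r2 : 0 < r / 2 by lra.
  have x1 : 0 < `|x| + 1 by rewrite ltr_pwDr.
  have [K1 h1] := (wnullP v).1 v0 x _ r2.
  have [K2 h2] := uv (r / 2 / (`|x| + 1)) (divr_gt0 r2 x1).
  exists (maxn K1 K2) => k; rewrite geq_max => /andP[/h1 {}h1 /h2 {}h2].
  have h3 : `|(v k - u k) x| <= r / 2.
    apply: (le_trans (dual_norm_mul _ _)).
    move: h2; rewrite ltr_pdivlMr// => /ltW; apply: le_trans.
    by rewrite ler_wpM2l// lerDl.
  rewrite dualB in h3; have -> : u k x = v k x - (v k x - u k x) by lra.
  by apply: (le_lt_trans (ler_normB _ _)); lra.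
have d2 : 0 < d / 2 by lra.
have e1 : 0 < `|e ord0| + 1 by rewrite ltr_pwDr.
have [K1 h1] := uv _ d2.
have [K2 h2] := line_coef_to0 sY cY Ye0 u0 uY (divr_gt0 d2 e1).
exists (maxn K1 K2) => k; rewrite geq_max => /andP[/h1 {}h1 /h2 {}h2].
rewrite opprB addrCA; apply: (le_lt_trans (ler_normD _ _)).
have : `|b k *: e ord0| <= d / 2.
  rewrite normrZ; move: h2; rewrite ltr_pdivlMr// => /ltW; apply: le_trans.
  by rewrite ler_wpM2l// lerDl.
by move=> h3; lra.
Qed.

Lemma cof_approx Y (v : nat -> X') : cof_wstar Y -> wnull v ->
  exists u : nat -> X', (forall k, Y (u k)) /\
    forall d : R, 0 < d -> exists K, forall k, (K <= k)%N -> `|v k - u k| < d.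
Proof. by move=> [sY cY [n [e Ye]]]; apply: codim_approx => //; exact: closed_wseq. Qed.

End FiniteCodim.

(** * AMUC* norms exclude uniformly separated bounded sign trees *)

Section Norms.
Context (R : realType) (X : normedModType R) (N : dual X -> R) (nN : is_norm N).
Local Notation X' := (dual X).

Lemma normfD f g : N (f + g) <= N f + N g. Proof. by case: nN. Qed.

Lemma normfZ (a : R) f : N (a *: f) = `|a| * N f. Proof. by case: nN. Qed.

Lemma normfN f : N (- f) = N f.
Proof. by rewrite -scaleN1r normfZ normrN1 mul1r. Qed.

Lemma normf0 : N 0 = 0.
Proof. by rewrite -(scale0r (0 : X')) normfZ normr0 mul0r. Qed.

Lemma normfB f g : N (f - g) <= N f + N g.
Proof. by rewrite -[N g]normfN; exact: normfD. Qed.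

Lemma normf_gap f g : `|N f - N g| <= N (f - g).
Proof.
rewrite ler_norml; have h1 := normfD (f - g) g; have h2 := normfD (g - f) f.
by rewrite !subrK in h1 h2; move: h2; rewrite -[g - f]opprB normfN; lra.
Qed.

Lemma normf_max_ge f g : N f <= Num.max (N (f + g)) (N (f - g)).
Proof.
have := normfD (f + g) (f - g); rewrite addrACA subrr addr0 -mulr2n.
by rewrite -scaler_nat normfZ ger0_norm// le_max; case: lerP => //= ? ?; lra.
Qed.

(** A convex even function of one real variable is nondecreasing on the
    half-line. *)
Lemma normf_max_mono f g (a : R) : 0 <= a <= 1 ->
  Num.max (N (f + a *: g)) (N (f - a *: g)) <= Num.max (N (f + g)) (N (f - g)).
Proof.
move=> /andP[a0 a1]; set M := Num.max (N (f + g)) _.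
have hp : N (f + g) <= M by rewrite le_max lexx.
have hm : N (f - g) <= M by rewrite le_max lexx orbT.
suff half h : N (f + h) <= M -> N (f - h) <= M -> N (f + a *: h) <= M.
  by rewrite ge_max half//= -scalerN half ?opprK.
move=> fp fm.
have -> : f + a *: h = ((1 + a) / 2) *: (f + h) + ((1 - a) / 2) *: (f - h).
  rewrite !scalerDr !scalerN addrACA -scalerDl -scalerBl.
  by congr (_ + _); [rewrite -[LHS]scale1r|]; congr (_ *: _); lra.
apply: (le_trans (normfD _ _)); rewrite !normfZ !ger0_norm; try lra.
have h1 : (1 + a) / 2 * N (f + h) <= (1 + a) / 2 * M by rewrite ler_wpM2l//; lra.
have h2 : (1 - a) / 2 * N (f - h) <= (1 - a) / 2 * M by rewrite ler_wpM2l//; lra.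
by lra.
Qed.

End Norms.

Section AsymptoticSpheres.
Context (R : realType) (X : normedModType R) (N : dual X -> R)
  (eN : equivalent_norm N).
Local Notation X' := (dual X).
Let nN : is_norm N := eN.1.

(** Normalising at most doubles the relative error of the approximation in
    [cof_approx]; the lower bound [d] makes that error small. *)
Lemma cof_sphere_approx (Y : set X') (v : nat -> X') (d eta : R) :
  cof_wstar Y -> wnull v -> 0 < d -> (forall k, d <= `|v k|) -> 0 < eta ->
  exists K, forall k, (K <= k)%N -> exists2 y, sphere_of N Y y &
    N ((N (v k))^-1 *: v k - y) <= eta.
Proof.
move=> cY v0 d0 dv eta0; have [c [C [c0 C0 cC]]] := eN.2.
have [u [uY uv]] := cof_approx cY v0.
pose q := Num.min 1 eta * (c * d) / 2.
have m0 : 0 < Num.min 1 eta by rewrite lt_min ltr01.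
have cd0 : 0 < c * d by rewrite mulr_gt0.
have q0 : 0 < q by rewrite divr_gt0// mulr_gt0.
have [K Kk] := uv _ (divr_gt0 q0 C0).
exists K => k /Kk; rewrite ltr_pdivlMr// mulrC => vuq.
have Nq : N (v k - u k) < q.
  by apply: le_lt_trans vuq; have /andP[] := cC (v k - u k).
have rcd : c * d <= N (v k).
  by have /andP[+ _] := cC (v k); apply: le_trans; rewrite ler_wpM2l// ltW.
set r := N (v k) in rcd *; set s := N (u k).
have gap : `|r - s| <= N (v k - u k) by exact: normf_gap.
have q1 : q <= c * d / 2.
  rewrite /q -mulrA -[leRHS]mul1r ler_wpM2r ?ge_min ?lexx//; lra.
have q2 : q <= eta * (c * d) / 2.
  rewrite /q -!mulrA ler_wpM2r ?ge_min ?lexx ?orbT//; lra.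
have s0 : 0 < s by move: gap; rewrite ler_norml; lra.
have r0 : 0 < r by lra.
exists (s^-1 *: u k).
  split; first by apply: subspaceZ; [case: cY|exact: uY].
  by rewrite /= normfZ// ger0_norm ?invr_ge0 ?(ltW s0)// mulVf ?gt_eqF.
have -> : r^-1 *: v k - s^-1 *: u k = r^-1 *: (v k - u k) + (r^-1 - s^-1) *: u k.
  by rewrite scalerBr scalerBl addrA subrK.
apply: (le_trans (normfD nN _ _)); rewrite !normfZ// -/s.
have -> : `|r^-1 - s^-1| * s = r^-1 * `|r - s|.
  have -> : r^-1 - s^-1 = (r * s)^-1 * (s - r) by field; rewrite ?gt_eqF.
  rewrite normrM gtr0_norm ?invr_gt0 ?mulr_gt0// distrC.
  by field; rewrite ?gt_eqF.
rewrite ger0_norm ?invr_ge0 ?(ltW r0)// -mulrDr ler_pdivrMl//.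
have : eta * (c * d) <= r * eta by rewrite mulrC ler_wpM2r// ltW.
by lra.
Qed.

Lemma ereal_gt0_real (a : \bar R) : (0 < a)%E -> exists2 r : R, 0 < r & (r%:E < a)%E.
Proof.
case: a => [r| |//]; first by rewrite lte_fin => r0; exists (r / 2); rewrite ?lte_fin; lra.
by move=> _; exists 1; rewrite ?ltr01// ltry.
Qed.

Lemma AMUCstar_gain (t : R) : AMUCstar N -> 0 < t -> exists2 gam : R, 0 < gam &
  forall x, N x = 1 -> exists2 Y, cof_wstar Y & forall y, sphere_of N Y y ->
    1 + gam <= Num.max (N (x + t *: y)) (N (x - t *: y)).
Proof.
move=> aN t0; have [gam gam0 gamlt] := ereal_gt0_real (aN t t0).
exists gam => // x x1.
have /ereal_sup_gt[_ [Y cY <-] Ygt] := lt_le_trans gamlt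
  (ereal_inf_lbound (imageP _ (conj Logic.I x1 : sphere_of N setT x))).
exists Y => // y yY.
have := lt_le_trans Ygt (ereal_inf_lbound (imageP _ yY)).
by rewrite lte_fin; lra.
Qed.

(** One step up a branch. The vectors [v k] are close to the sphere of the
    subspace that witnesses the AMUC* property at the normalisation of [z], and
    replacing the multiplier [N (v k) / N z] by the smaller constant [m / M]
    only lowers the maximum over signs. *)
Lemma AMUCstar_step (m M : R) : AMUCstar N -> 0 < m -> m <= M ->
  exists2 eta : R, 0 < eta & forall (z : X') (v : nat -> X') (d : R),
    wnull v -> 0 < d -> (forall k, d <= `|v k|) -> (forall k, m <= N (v k)) ->
    m <= N z <= M -> exists k, exists b : bool, N z + eta <= N (z + (-1) ^+ b *: v k).
Proof.
move=> aN m0 mM; have M0 : 0 < M by lra.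
have t0 : 0 < m / M by rewrite divr_gt0.
have [gam gam0 Hgam] := AMUCstar_gain aN t0.
exists (m * (gam / 2)); first by rewrite mulr_gt0//; lra.
move=> z v d v0 d0 dv mv /andP[mz zM]; have z0 : 0 < N z by lra.
have nz : N ((N z)^-1 *: z) = 1.
  by rewrite normfZ// ger0_norm ?invr_ge0 ?(ltW z0)// mulVf ?gt_eqF.
have [Y cY HY] := Hgam _ nz.
have g2 : 0 < gam / 2 / (m / M) by rewrite divr_gt0//; lra.
have [K /(_ K (leqnn K))[y yY ya]] := cof_sphere_approx cY v0 d0 dv g2.
exists K; set w := (N (v K))^-1 *: v K in ya.
have yw b : N ((N z)^-1 *: z + (-1) ^+ (b : bool) *: ((m / M) *: y))
    <= N ((N z)^-1 *: z + (-1) ^+ b *: ((m / M) *: w)) + gam / 2.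
  have -> : (N z)^-1 *: z + (-1) ^+ b *: ((m / M) *: y) =
      ((N z)^-1 *: z + (-1) ^+ b *: ((m / M) *: w)) -
      (-1) ^+ b *: ((m / M) *: (w - y)).
    by rewrite !scalerBr opprB addrACA subrr addr0.
  apply: (le_trans (normfB nN _ _)); rewrite lerD2l normfZ// normrX normrN1 expr1n mul1r.
  rewrite normfZ// (gtr0_norm t0) mulrC.
  by apply: (le_trans (ler_wpM2r (ltW t0) ya)); rewrite divfK ?gt_eqF.
have gain : N z + m * (gam / 2) <= Num.max (N (z + v K)) (N (z - v K)).
  have vK0 : 0 < N (v K) by have := mv K; lra.
  pose a := N z * (m / M) / N (v K).
  have a01 : 0 <= a <= 1.
    apply/andP; split; first exact: divr_ge0 (mulr_ge0 (ltW z0) (ltW t0)) (ltW vK0).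
    rewrite /a ler_pdivrMr// mul1r (le_trans _ (mv K))// mulrCA ger_pMr//.
    by rewrite ler_pdivrMr// mul1r.
  apply: le_trans (normf_max_mono nN z (v K) a01).
  have sc (b : bool) : N (z + (-1) ^+ b *: (a *: v K)) =
      N z * N ((N z)^-1 *: z + (-1) ^+ b *: ((m / M) *: w)).
    rewrite -[X in X * N _](gtr0_norm z0) -normfZ// scalerDr !scalerA.
    rewrite divff ?gt_eqF// scale1r; congr (N (_ + _ *: _)).
    by rewrite /a; ring.
  have := HY y yY; have := yw true; have := yw false.
  have := sc true; have := sc false.
  rewrite !expr0 !expr1 !scale1r !scaleN1r => -> ->.
  set p := N (_ + (m / M) *: w); set p' := N (_ - (m / M) *: w) => h1 h2 h3.
  have h4 : 1 + gam / 2 <= Num.max p p'.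
    by move: h3; rewrite !le_max => /orP[h|h]; apply/orP; [left|right]; lra.
  rewrite -maxr_pMr ?(ltW z0)//; apply: le_trans (ler_wpM2l (ltW z0) h4).
  rewrite mulrDr mulr1 lerD2l ler_wpM2r//; lra.
move: gain; rewrite le_max => /orP[h|h]; [exists false|exists true].
  by rewrite expr0 scale1r.
by rewrite expr1 scaleN1r.
Qed.

End AsymptoticSpheres.

Section NoStar.
Context (R : realType) (X : normedModType R).
Local Notation X' := (dual X).

Definition signed_sum (x : seq nat -> X') (b : nat -> bool) (s : seq nat) n :=
  x [::] + \sum_(1 <= i < n.+1) (-1) ^+ b i *: x (take i s).

Lemma signed_sum_rcons x b s k (c : bool) :
  signed_sum x (fun i => if i == (size s).+1 then c else b i) (rcons s k) (size s).+1
    = signed_sum x b s (size s) + (-1) ^+ c *: x (rcons s k).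
Proof.
rewrite /signed_sum big_nat_recr//= eqxx.
rewrite (@take_oversize _ (size s).+1) ?size_rcons// addrA; congr (_ + _ + _).
apply: eq_big_nat => i /andP[_ ilt]; rewrite ltn_eqF// -cats1 takel_cat//.
Qed.

(** Along a tree of large height the signs can be chosen so that the AMUC* norm
    grows by a fixed amount at each step, which a bounded set does not allow. *)
Lemma AMUCstar_no_star (N : X' -> R) : equivalent_norm N -> AMUCstar N ->
  ~ property_star X.
Proof.
move=> eN aN [eps eps0 star]; have [nN [c [C [c0 C0 cC]]]] := eN.
have ce0 : 0 < c * eps by rewrite mulr_gt0.
have mM : c * eps <= C + c * eps + 1 by lra.
set M := C + c * eps + 1 in mM.
have [eta eta0 step] := AMUCstar_step eN aN ce0 mM.
have [n nC] : exists n : nat, C < c * eps + n%:R * eta.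
  exists (Num.bound (C / eta)).
  have := archi_boundP (divr_ge0 (ltW C0) (ltW eta0)).
  by rewrite ltr_pdivrMr//; lra.
have [x [x0 xB xe xs]] := star n.+1 isT.
(* The step needs an upper bound [M] on the current norm. Past [M], which exceeds
   the bound [C] for the final sum, it suffices not to decrease. *)
have grow i : (i <= n)%N -> exists s b, size s = i.+1 /\
    Num.min M (c * eps + i%:R * eta) <= N (signed_sum x b s i.+1).
  elim: i => [_|i IH ilt].
    have := normf_max_ge nN (x [:: 0%N]) (x [::]).
    have e1 : c * eps <= N (x [:: 0%N]).
      have /andP[+ _] := cC (x [:: 0%N]); apply: le_trans.
      by rewrite ler_wpM2l ?(ltW c0)// xe.
    rewrite le_max => /orP[h|h].
      exists [:: 0%N], (fun=> false); split=> //.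
      rewrite ge_min mul0r addr0 /signed_sum big_nat1 expr0 scale1r addrC.
      by rewrite (le_trans e1 h) orbT.
    exists [:: 0%N], (fun=> true); split=> //.
    rewrite ge_min mul0r addr0 /signed_sum big_nat1 expr1 scaleN1r.
    by rewrite -(normfN nN) opprB (le_trans e1 h) orbT.
  have [s [b [ss sb]]] := IH (ltnW ilt).
  suff [k [c' kc]] : exists k, exists c' : bool,
      Num.min M (c * eps + i.+1%:R * eta) <=
      N (signed_sum x b s i.+1 + (-1) ^+ c' *: x (rcons s k)).
    have := signed_sum_rcons x b s k c'; rewrite ss => E.
    exists (rcons s k), (fun j => if j == i.+2 then c' else b j).
    by rewrite size_rcons ss E.
  set z := signed_sum x b s i.+1 in sb *.
  have [zM|zM] := lerP (N z) M; last first.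
    have := normf_max_ge nN z (x (rcons s 0%N)); rewrite le_max => /orP[h|h].
      by exists 0%N, false; rewrite expr0 scale1r ge_min (le_trans (ltW zM) h).
    by exists 0%N, true; rewrite expr1 scaleN1r ge_min (le_trans (ltW zM) h).
  have xk k : eps <= `|x (rcons s k)|.
    by apply: xe; [case: (s)|rewrite size_rcons ss].
  have Nk k : c * eps <= N (x (rcons s k)).
    have /andP[+ _] := cC (x (rcons s k)); apply: le_trans.
    by rewrite ler_wpM2l ?(ltW c0).
  have i0 : 0 <= i%:R * eta by rewrite mulr_ge0// ltW.
  have zm : c * eps <= N z.
    by apply: le_trans sb; rewrite le_min mM; lra.
  have nv : wnull (fun k => x (rcons s k)) by apply: x0; rewrite ss.
  have [k [c' kc]] := step z _ eps nv eps0 xk Nk (introT andP (conj zm zM)).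
  exists k, c'; apply: le_trans kc; move: sb; rewrite !ge_min mulrSr.
  case/orP => h; apply/orP; [left|right]; lra.
have [s [b [ss sb]]] := grow n (leqnn n).
have := xs s b ss; rewrite /dual_ball/= -/(signed_sum x b s n.+1) => zB.
have : N (signed_sum x b s n.+1) <= C.
  have /andP[_] := cC (signed_sum x b s n.+1); move/le_trans; apply.
  by rewrite -[leRHS]mulr1 ler_wpM2l// ltW.
by move: sb; rewrite ge_min => /orP[|]; rewrite /M; lra.
Qed.

End NoStar.

(** * Large Szlenk index produces sign trees *)

Section Trees.
Context (R : realType) (X : normedModType R).
Local Notation X' := (dual X).
Local Notation B := (@dual_ball R X).

Lemma dual_ballB2 (f g : X') : B f -> B g -> `|f - g| <= 2.
Proof. by rewrite /dual_ball/= => f1 g1; apply: (le_trans (ler_normB _ _)); lra. Qed.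

Lemma separable_seq (T : topologicalType) : separable_space T -> forall x0 : T,
  exists d : nat -> T, forall O : set T, O !=set0 -> open O -> exists i, O (d i).
Proof.
move=> [D [/countable_injP[h hinj] dD]] x0.
have /choice[d hd] : forall i, exists y, forall x, D x -> h x = i -> y = x.
  move=> i; have [[y [Dy hy]]|ny] := EM (exists y, D y /\ h y = i).
    by exists y => x Dx hx; apply: hinj; rewrite ?inE// hx.
  by exists x0 => x Dx hx; case: ny; exists x.
exists d => O O0 oO; have [x [Ox Dx]] := dD O O0 oO.
by exists (h x); rewrite (hd _ x Dx erefl).
Qed.

Lemma finite_eval_near (f : X') (d : nat -> X) (n : nat) (e : R) : 0 < e ->
  exists U : set (weak_star X),
    [/\ open U, U f & forall g, U g -> forall i, (i < n)%N -> `|g (d i) - f (d i)| < e].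
Proof.
move=> e0; elim: n => [|n [U [oU Uf HU]]]; first by exists setT; split=> //; exact: openT.
have [V [oV Vf HV]] := eval_near f (d n) e0.
exists (U `&` V); split=> //; first exact: openI.
by move=> g [Ug Vg] i; rewrite ltnS leq_eqVlt => /orP[/eqP->|]; [exact: HV|exact: HU].
Qed.

(** On bounded sets of the dual of a separable space, weak* neighbourhoods given
    by the first [m] points of a dense sequence suffice, and a weak* neighbourhood
    of diameter larger than [eps] has a point at distance larger than [eps / 2]
    from its centre. *)
Lemma szlenk_deriv_seq (eps : R) (K : set X') (f : X') : separable_space X ->
  K `<=` B -> szlenk_deriv eps K f ->
  exists g : nat -> X', [/\ forall k, K (g k), wnull (fun k => g k - f) &
    forall k, eps / 2 < `|g k - f|].
Proof.
move=> sepX KB [Kf nf]; have [d dd] := separable_seq sepX (0 : X).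
have inv0 m : 0 < m.+1%:R^-1 :> R by rewrite invr_gt0 ltr0n.
have /choice[g gP] : forall m, exists g, [/\ K g, eps / 2 < `|g - f| &
    forall i, (i < m)%N -> `|g (d i) - f (d i)| < m.+1%:R^-1].
  move=> m; have [U [oU Uf HU]] := finite_eval_near f d m (inv0 m).
  have : ~ (diam (K `&` U) <= eps%:E)%E.
    by move=> dKU; apply: nf; exists (K `&` U) => //; split=> //; exists U.
  move/negP; rewrite -ltNge => /ereal_sup_gt[_ [[p q] [/= [Kp Up] [Kq Uq]] <-]].
  rewrite lte_fin => pq.
  have [pf|pf] := ltP (eps / 2) `|p - f|; first by exists p; split=> //; exact: HU.
  exists q; split=> //; last exact: HU.
  have : `|p - q| <= `|p - f| + `|q - f|.
    by rewrite -(normrN (q - f)) opprB -[p - q](subrKA f) ler_normD.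
  by lra.
exists g; split=> [k||k]; [by case: (gP k)| |by case: (gP k)].
apply/wnullP => x r r0.
have [i xi] : exists i, ball x (r / 4) (d i).
  by apply: dd; [exists x; apply: ballxx; lra|exact: ball_open].
have r2 : 0 < r / 2 by lra.
have [N rN] : exists N : nat, (r / 2)^-1 < N%:R.
  by exists (Num.bound (r / 2)^-1); apply: archi_boundP; rewrite invr_ge0 ltW.
exists (maxn N i.+1) => k; rewrite geq_max => /andP[Nk ik].
have [Kg _ gd] := gP k; have := gd i ik.
have kr : k.+1%:R^-1 < r / 2.
  rewrite -[r / 2]invrK ltf_pV2 ?posrE ?ltr0n ?invr_gt0//.
  by apply: lt_le_trans rN _; rewrite ler_nat ltnW.
have xd : `|(g k - f) (x - d i)| <= r / 2.
  apply: (le_trans (dual_norm_mul _ _)).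
  have h1 := dual_ballB2 (KB _ Kg) (KB _ Kf).
  have h2 : `|x - d i| <= r / 4 by apply: ltW; move: xi; rewrite -ball_normE.
  by apply: (le_trans (ler_pM _ _ h1 h2)) => //; lra.
rewrite -[in X in _ -> X](subrK (d i) x) dual_appD => h.
apply: (le_lt_trans (ler_normD _ _)).
by rewrite [(g k - f) (d i)]dualB [r]splitr; exact: ler_ltD xd (lt_trans h kr).
Qed.

(** Each derivation supplies a weak* convergent sequence of children of the
    current point, and the subspace chosen by the game is, up to [eta], a
    constraint on its tail only. *)
Lemma szlenk_tree (P : seq X' -> Prop) (eps eta : R) (m : nat) (z : X')
    (s : seq X') (r : X') : separable_space X -> 0 < eps -> 0 < eta ->
  szlenk_iter eps B (iter m osucc ozero) z -> asymptotic_game P m s ->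
  exists x : seq nat -> X', [/\ x [::] = r, wstar_null m x &
    forall t, size t = m -> exists fs, [/\ size fs = m, P (s ++ fs),
      B (z + \sum_(1 <= i < m.+1) x (take i t)) &
      forall i, (i < m)%N -> [/\ eps / 2 < `|x (take i.+1 t)|,
        `|x (take i.+1 t)| <= 2 &
        `| `|x (take i.+1 t)|^-1 *: x (take i.+1 t) - fs`_i| <= eta]]].
Proof.
move=> sepX eps0 eta0; elim: m z s r => [|m IH] z s r /= zm gm.
  exists (fun=> r); split=> [//|t //|t _]; exists [::].
  by rewrite cats0 big_geq// addr0; split.
have KB := @szlenk_iter_sub _ _ eps B (iter m osucc ozero).
have [g [Kg gz geps]] := szlenk_deriv_seq sepX KB zm.
have [Y cY gY] := gm.
have enorm : equivalent_norm (fun f : X' => `|f|).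
  split; last by exists 1, 1; split=> // f; rewrite mul1r lexx.
  by split; [exact: ler_normD|exact: normrZ|move=> f /normr0_eq0].
have e2 : 0 < eps / 2 by lra.
have [K HK] := cof_sphere_approx enorm cY gz e2 (fun k => ltW (geps k)) eta0.
have /choice[F HF] : forall k, exists y, sphere_of Num.norm Y y /\
    `| `|g (k + K)%N - z|^-1 *: (g (k + K)%N - z) - y| <= eta.
  by move=> k; have [y yY ya] := HK (k + K)%N (leq_addl _ _); exists y.
have /choice[x xP] := fun k => IH (g (k + K)%N) (rcons s (F k)) (g (k + K)%N - z)
  (Kg _) (gY _ (HF k).1).
exists (fun t => if t is k :: t' then x k t' else r); split=> //.
  move=> [_|k t tm]; last by have [_ xk _] := xP k; exact: (xk t tm).
  apply/wnullP => y d d0; have [L HL] := (wnullP _).1 gz y d d0.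
  exists L => k Lk; have [/= -> _ _] := xP k.
  by apply: HL; rewrite (leq_trans Lk)// leq_addr.
move=> [//|k t] [tm]; have [xk0 _ /(_ t tm)[fs [fsm Pfs zB fsP]]] := xP k.
exists (F k :: fs); split; first by rewrite /= fsm.
- by rewrite -cat_rcons.
- rewrite big_ltn// big_add1/= take0 xk0 addrA addrCA subrr addr0.
  exact: zB.
- move=> [_|i im] /=; last by apply: fsP.
  rewrite take0 xk0; split; [exact: geps| |exact: (HF k).2].
  by apply: dual_ballB2; [apply: KB; exact: Kg|case: zm => /KB].
Qed.

(** The branches of the tree are almost [C]-unconditional, so from the bound 2 on
    the sum of a branch all its signed sums are bounded. These sums leave out the
    root, so that after rescaling 0 can serve as the root. *)
Lemma szlenk_property_star (eps : R) : separable_space X ->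
  wstar_unconditional_structure X -> 0 < eps ->
  (forall n, szlenk_iter eps B (iter n osucc ozero) !=set0) -> property_star X.
Proof.
move=> sepX [C C1 uC] eps0 ne; have C4 : 0 < 4 * C by lra.
exists (eps / 2 / (4 * C)); first by rewrite divr_gt0//; lra.
move=> n n1; have n0 : 0 < n%:R :> R by rewrite ltr0n.
pose eta : R := (2 * n%:R)^-1; have eta0 : 0 < eta by rewrite invr_gt0; lra.
have [z zn] := ne n; have zB : B z := szlenk_iter_sub zn.
(* Replacing the [n] vectors of a branch by multiples of the game's vectors costs
   [n * (2 * eta) = 1] in total, once before and once after changing signs:
   the signed sums are bounded by [C * (2 + 1) + 1 <= 4 * C]. *)
have [x [x0 xnull xP]] := szlenk_tree 0 sepX eps0 eta0 zn (uC n n1).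
have iC : `|(4 * C)^-1| = (4 * C)^-1 by rewrite ger0_norm// invr_ge0 ltW.
exists (fun t => (4 * C)^-1 *: x t); split.
- move=> t tn; apply/wnullP => y d d0.
  have [K HK] := (wnullP _).1 (xnull t tn) y (4 * C * d) (mulr_gt0 C4 d0).
  by exists K => k /HK; rewrite dualZ normrM iC ltr_pdivrMl.
- by rewrite /dual_ball/= x0 scaler0 normr0.
- move=> t t0 tn; have tpos : (0 < size t)%N by case: (t) t0.
  have st : size (t ++ nseq (n - size t) 0%N) = n by rewrite size_cat size_nseq subnKC.
  have [fs [_ _ _ /(_ (size t).-1)]] := xP _ st.
  rewrite prednK// take_size_cat// => -[//|/ltW xt _ _].
  by rewrite normrZ iC [leLHS]mulrC ler_wpM2l// invr_ge0 ltW.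
- move=> t b tn; have [fs [fsn uf sB fsP]] := xP t tn.
  rewrite /dual_ball/= x0 scaler0 add0r.
  rewrite big_add1/= big_mkord; under eq_bigr do rewrite scalerA mulrC -scalerA.
  rewrite -scaler_sumr normrZ iC ler_pdivrMl// mulr1.
  move: sB; rewrite big_add1/= big_mkord => sB.
  pose a i := `|x (take i.+1 t)|.
  have near (i : 'I_n) : `|a i *: fs`_i - x (take i.+1 t)| <= 2 * eta.
    have [ai_gt ai2 aeta] := fsP i (ltn_ord i); rewrite -/(a i) in ai_gt ai2 aeta.
    have ai0 : 0 < a i by lra.
    have -> : a i *: fs`_i - x (take i.+1 t) =
        - (a i *: ((a i)^-1 *: x (take i.+1 t) - fs`_i)).
      by rewrite scalerBr scalerA divff ?gt_eqF// scale1r opprB.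
    rewrite normrN normrZ normr_id.
    by apply: ler_pM => //; rewrite /a normr_id in ai2 *.
  have nearS (c : 'I_n -> bool) :
      `|\sum_(i < n) (((-1) ^+ c i * a i) *: fs`_i - (-1) ^+ c i *: x (take i.+1 t))| <= 1.
    apply: (le_trans (ler_norm_sum _ _ _)).
    apply: (@le_trans _ _ (\sum_(i < n) (2 * eta))).
      apply: ler_sum => i _; rewrite -scalerA -scalerBr normrZ normrX normrN1 expr1n mul1r.
      exact: near.
    rewrite sumr_const card_ord -[_ *+ n]mulr_natl.
    have -> : n%:R * (2 * eta) = 1 by rewrite /eta; field; rewrite gt_eqF.
    exact: lexx.
  have := uf a (fun i => b i.+1); rewrite cat0s fsn.
  set u := \sum_(i < n) _; set w := \sum_(i < n) _ => uw.
  have w3 : `|w| <= 3.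
    have := nearS (fun=> false).
    under eq_bigr do rewrite !expr0 mul1r scale1r.
    rewrite sumrB -/w => h.
    rewrite -[w](subrK (\sum_(i < n) x (take i.+1 t))).
    apply: (le_trans (ler_normD _ _)).
    have := dual_ballB2 sB zB; rewrite addrAC subrr add0r.
    by lra.
  have := nearS (fun i => b i.+1); rewrite sumrB.
  rewrite -/u; set v := \sum_(i < n) _ => uv.
  rewrite -[v](subKr u); apply: (le_trans (ler_normB _ _)).
  have : C * `|w| <= C * 3 by rewrite ler_wpM2l//; lra.
  by lra.
Qed.

Lemma least_ord_ex (P : ord -> Prop) a : P a ->
  exists2 b, least_ord P = Some b & is_least P b.
Proof.
move=> Pa; rewrite /least_ord; case: pselect => [h|[]]; last exact: is_least_ex Pa.
by exists (projT1 (cid h)) => //; case: (cid h).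
Qed.

Lemma szlenk_index_le_omega :
  (forall eps : R, 0 < eps -> exists n, szlenk_iter eps B (iter n osucc ozero) = set0) ->
  xole (szlenk_index X) (Some omega).
Proof.
move=> fin; have at_le (eps : {posnum R}) :
    exists2 a, szlenk_at B eps%:num = Some a & ole a omega.
  have [n sn] := fin eps%:num (ltac:(by [])).
  have [a aE [_ aleast]] := @least_ord_ex (fun a => szlenk_iter eps%:num B a = set0) _ sn.
  by exists a => //; apply: ole_trans (aleast _ sn) _; exact: ole_lim (ole_refl _).
rewrite /szlenk_index /xosup asboolT; last by move=> eps; have [a -> _] := at_le eps.
by move=> eps; have [a -> ] := at_le eps.
Qed.

Lemma szlenk_le_omega_of_no_star : separable_space X ->
  wstar_unconditional_structure X -> ~ property_star X ->
  xole (szlenk_index X) (Some omega).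
Proof.
move=> sepX uX nstar; apply: szlenk_index_le_omega => eps eps0.
apply: contrapT => nn; apply: nstar; apply: (szlenk_property_star sepX uX eps0) => n.
by apply/set0P/eqP => sn; apply: nn; exists n.
Qed.

End Trees.

(** * Finite Szlenk derivations produce an AUC* norm *)

Section Derivations.
Context (R : realType) (X : normedModType R).
Local Notation X' := (dual X).
Local Notation B := (@dual_ball R X).

Lemma szlenk_deriv_closed (eps : R) (K : set X') :
  closed (K : set (weak_star X)) ->
  closed (szlenk_deriv eps K : set (weak_star X)).
Proof.
move=> cK.
have -> : (szlenk_deriv eps K : set (weak_star X)) = K `&` ~` \bigcup_(U in
    [set U : set (weak_star X) | open U /\ (diam (K `&` U) <= eps%:E)%E]) U.
  apply/seteqP; split=> f [Kf nf]; split=> // -[].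
    by move=> U [oU dU] Uf; apply: nf; exists (K `&` U) => //; split=> //; exists U.
  by move=> _ [[U oU ->] dU] [_ Uf]; apply: nf; exists U.
by apply: closedI => //; apply: open_closedC; apply: bigcup_open => U [].
Qed.

Lemma szlenk_iter_closed (eps : R) n :
  closed (szlenk_iter eps B (iter n osucc ozero) : set (weak_star X)).
Proof.
elim: n => [|n IH] /=; first exact: dual_ball_closed.
exact: szlenk_deriv_closed.
Qed.

Lemma szlenk_iter_nat_anti (eps : R) m n : (m <= n)%N ->
  szlenk_iter eps B (iter n osucc ozero) `<=` szlenk_iter eps B (iter m osucc ozero).
Proof.
by move=> /subnK <-; elim: (n - m)%N => [//|k IH] f /szlenk_deriv_sub; exact: IH.
Qed.

(** The finite derivations decrease and are weak* compact, so they cannot all be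
    nonempty once their intersection is empty. *)
Lemma szlenk_finite (eps : R) : xole (szlenk_index X) (Some omega) -> 0 < eps ->
  exists n, szlenk_iter eps B (iter n osucc ozero) = set0.
Proof.
move=> Sz eps0; have inter f : B f ->
    exists n, ~ szlenk_iter eps B (iter n osucc ozero) f.
  move=> fB; apply: contrapT => nn; move: Sz; rewrite /szlenk_index /xosup.
  case: asboolP => // fin /(_ (PosNum eps0)); have := fin (PosNum eps0).
  rewrite /szlenk_at /least_ord /=; case: pselect => // h _.
  case: cid => /= a [a0 _] /(szlenk_iter_anti (eps := eps) (K := B)) /(_ f).
  rewrite a0 => -[]; split=> // n _; apply: contrapT => nf; apply: nn.
  by exists n.
have /choice[h hP] : forall f, exists n, B f ->
    ~ szlenk_iter eps B (iter n osucc ozero) f.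
  move=> f; have [/inter[n nf]|nB] := EM (B f); first by exists n.
  by exists 0%N.
have [|s sB sP] := @dual_ball_cover R X
    (fun f => ~` szlenk_iter eps B (iter (h f) osucc ozero)).
  move=> f fB; split; last exact: hP.
  by apply: closed_openC; exact: szlenk_iter_closed.
exists (\max_(f <- s) h f); apply/seteqP; split=> // g gn.
have [f fs] := sP g (szlenk_iter_sub gn); apply.
by apply: szlenk_iter_nat_anti gn; exact: leq_bigmax_seq.
Qed.

End Derivations.

Section Weight.
Context (R : realType) (X : normedModType R).
Local Notation X' := (dual X).
Local Notation B := (@dual_ball R X).
Implicit Types (C : nat -> set X') (u : X').

(** Each [u] is charged for the closed sets that it has left. Since complements
    of closed sets are open, a finite part of the charge can only grow when [u]
    moves slightly in the weak* topology. *)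
Definition weight_sum C n u : R := \sum_(i < n) 2^-1 ^+ i.+1 * (u \notin C i)%:R.

Definition weight C u : R := 1 + sup (range (fun n => weight_sum C n u)).

Lemma half_pow_gt0 i : 0 < 2^-1 ^+ i :> R.
Proof. by rewrite exprn_gt0// invr_gt0. Qed.

Lemma weight_sum_le1 C n u : weight_sum C n u <= 1.
Proof.
suff : weight_sum C n u <= 1 - 2^-1 ^+ n by have := half_pow_gt0 n; lra.
elim: n => [|n IH]; first by rewrite /weight_sum big_ord0 expr0 subrr.
rewrite /weight_sum big_ord_recr/= -/(weight_sum C n u).
have := half_pow_gt0 n; rewrite exprS; case: (_ \notin _); rewrite ?mulr0 ?mulr1; lra.
Qed.

Lemma weight_sum_mono C u m n : (m <= n)%N -> weight_sum C m u <= weight_sum C n u.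
Proof.
move=> /subnK <-; elim: (n - m)%N => [//|k IH]; apply: (le_trans IH).
rewrite /weight_sum addSn big_ord_recr/= lerDl mulr_ge0 ?ler0n// ltW//.
Qed.

Lemma weight_has_sup C u : has_sup (range (fun n => weight_sum C n u)).
Proof.
split; first by exists (weight_sum C 0 u); exists 0%N.
by exists 1 => _ [n _ <-]; exact: weight_sum_le1.
Qed.

Lemma weight_ge C n u : 1 + weight_sum C n u <= weight C u.
Proof.
by rewrite lerD2l; apply: ub_le_sup; [case: (weight_has_sup C u)|exists n].
Qed.

Lemma weight_bounds C u : 1 <= weight C u <= 2.
Proof.
apply/andP; split.
  by have := weight_ge C 0 u; rewrite /weight_sum big_ord0 addr0.
rewrite /weight -[2]/(1 + 1 : R) lerD2l; apply: ge_sup.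
  by case: (weight_has_sup C u).
by move=> _ [n _ <-]; exact: weight_sum_le1.
Qed.

Lemma weight_approx C u (e : R) : 0 < e ->
  exists n, weight C u < 1 + weight_sum C n u + e.
Proof.
move=> e0; have [_ [n _ <-] h] := sup_adherent e0 (weight_has_sup C u).
by exists n; rewrite /weight; lra.
Qed.

Lemma weight_sum_jump C n u u0 i : (i < n)%N ->
  (forall j, (j < n)%N -> ~ C j u0 -> ~ C j u) -> C i u0 -> ~ C i u ->
  weight_sum C n u0 + 2^-1 ^+ i.+1 <= weight_sum C n u.
Proof.
move=> ilt sub Ci0 Ci; rewrite /weight_sum.
rewrite (bigD1 (Ordinal ilt))//= [leRHS](bigD1 (Ordinal ilt))//=.
rewrite (memNset Ci) (mem_set Ci0) mulr0 mulr1 add0r [leLHS]addrC lerD2l.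
apply: ler_sum => j _; rewrite ler_wpM2l ?(ltW (half_pow_gt0 _))//.
have [Cj|Cj] := EM (C j u0); first by rewrite (mem_set Cj) ler0n.
by rewrite (memNset Cj) (memNset (sub j (ltn_ord j) Cj)).
Qed.

Lemma weight_sum_sub C n u u0 :
  (forall j, (j < n)%N -> ~ C j u0 -> ~ C j u) ->
  weight_sum C n u0 <= weight_sum C n u.
Proof.
move=> sub; apply: ler_sum => j _; rewrite ler_wpM2l ?(ltW (half_pow_gt0 _))//.
have [Cj|Cj] := EM (C j u0); first by rewrite (mem_set Cj) ler0n.
by rewrite (memNset Cj) (memNset (sub j (ltn_ord j) Cj)).
Qed.

Lemma closed_avoid C n u0 : (forall i, closed (C i : set (weak_star X))) ->
  exists U : set (weak_star X), [/\ open U, U u0 &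
    forall u, U u -> forall j, (j < n)%N -> ~ C j u0 -> ~ C j u].
Proof.
move=> cC; elim: n => [|n [U [oU Uu HU]]]; first by exists setT; split=> //; exact: openT.
have [Cn|Cn] := EM (C n u0).
  exists U; split=> // u /HU{}HU j; rewrite ltnS leq_eqVlt => /orP[/eqP->//|].
  exact: HU.
exists (U `&` ~` C n); split=> //; first by apply: openI => //; exact: closed_openC.
move=> u [/HU{}HU Cnu] j; rewrite ltnS leq_eqVlt => /orP[/eqP->//|].
exact: HU.
Qed.

(** The thresholds [1 / k.+1] are cofinal, so one sequence of closed sets serves
    every [eps]. An index that codes no pair gets the ball, which charges no
    element of the ball. *)
Definition szlenk_family i : set X' :=
  if (choice.unpickle i : option (nat * nat)) is Some (k, r)
  then szlenk_iter k.+1%:R^-1 B (iter r osucc ozero) else B.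

Lemma szlenk_family_closed i : closed (szlenk_family i : set (weak_star X)).
Proof.
rewrite /szlenk_family; case: choice.unpickle => [[k r]|]; first exact: szlenk_iter_closed.
exact: dual_ball_closed.
Qed.

(** Lower semicontinuity with a jump. If [u0] survives exactly [r] derivations at
    a threshold not exceeding [eps], a point weak* close to [u0] but at distance
    larger than [eps] has left the [r]-th derived set, and this adds one term to
    the sum; the terms that can occur for a given [eps] are finitely many. *)
Lemma weight_jump (eps : R) : xole (szlenk_index X) (Some omega) -> 0 < eps ->
  exists2 gam : R, 0 < gam & forall u0 (e : R), B u0 -> 0 < e ->
  exists U : set (weak_star X), [/\ open U, U u0 &
    forall u, U u -> B u ->
      weight szlenk_family u0 <= weight szlenk_family u + e /\
      (eps < `|u - u0| ->
       weight szlenk_family u0 + gam <= weight szlenk_family u + e)].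
Proof.
move=> Sz eps0; pose k := Num.bound eps^-1.
have keps : k.+1%:R^-1 <= eps.
  rewrite -[leRHS]invrK lef_pV2 ?posrE ?ltr0n ?invr_gt0// ltW//.
  have := archi_boundP (ltW (_ : 0 < eps^-1)); rewrite invr_gt0 => /(_ eps0).
  by move/lt_trans; apply; rewrite ltr_nat.
have k0 : 0 < k.+1%:R^-1 :> R by rewrite invr_gt0 ltr0n.
have [n nP] := szlenk_finite Sz k0.
(* The index [pickle (k, r)] of the term gained depends on [u0], but only through
   [r < n]; [m] makes the gain uniform. *)
pose m := \max_(r < n) (choice.pickle (k, r : nat)).+1.
exists (2^-1 ^+ m); first exact: half_pow_gt0.
move=> u0 e u0B e0; pose K r := szlenk_iter (k.+1%:R^-1 : R) B (iter r osucc ozero).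
have [r [rn Kr Kr1]] : exists r, [/\ (r < n)%N, K r u0 & ~ K r.+1 u0].
  have : ~ K n u0 by rewrite /K nP.
  elim: (n) => [|j IH] Kj; first by case: Kj.
  have [Kj'|/IH[r [rj Kr Kr1]]] := EM (K j u0); first by exists j.
  by exists r; split=> //; exact: ltnW.
have famE : szlenk_family (choice.pickle (k, r)) = K r by rewrite /szlenk_family choice.pickleK.
have [V [oV Vu0 Vd]] : exists V : set (weak_star X),
    [/\ open V, V u0 & (diam (K r `&` V) <= (k.+1%:R^-1)%:E)%E].
  apply: contrapT => nV; apply: Kr1; split=> // -[_ [[V oV ->] dV] [_ Vu0]].
  by apply: nV; exists V.
have rm : ((choice.pickle (k, r)).+1 <= m)%N by exact: (leq_bigmax (Ordinal rn)).
have [l lP] := weight_approx szlenk_family u0 e0.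
pose L := maxn l m; have [U [oU Uu0 HU]] := closed_avoid L u0 szlenk_family_closed.
have WL : weight szlenk_family u0 < 1 + weight_sum szlenk_family L u0 + e.
  have := weight_sum_mono szlenk_family u0 (leq_maxl l m); rewrite -/L; lra.
exists (U `&` V); split=> //; first exact: openI.
move=> u [Uu Vu] uB; have := weight_ge szlenk_family L u; split.
  by have := weight_sum_sub (HU u Uu); lra.
move=> far; have Ku : ~ szlenk_family (choice.pickle (k, r)) u.
  rewrite famE => Ku; move: far; rewrite ltNge => /negP; apply.
  apply: le_trans keps; rewrite -lee_fin; apply: le_trans Vd.
  by apply: ereal_sup_ubound; exists (u, u0).
have rL : (choice.pickle (k, r) < L)%N by rewrite leq_max rm orbT.
have := weight_sum_jump rL (HU u Uu) _ Ku; rewrite famE => /(_ Kr).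
have : 2^-1 ^+ m <= 2^-1 ^+ (choice.pickle (k, r)).+1 :> R.
  by apply: ler_wiXn2l => //; lra.
by lra.
Qed.

End Weight.

(** * An AUC* norm as a support function *)

Section Support.
Context (R : realType) (X : normedModType R) (W : dual X -> R)
  (W12 : forall u, 1 <= W u <= 2).
Local Notation X' := (dual X).
Local Notation B := (@dual_ball R X).

(** For constant [W] this would be a ball of [X]. As [W] lies between 1 and 2, it
    is sandwiched between the balls of radius 1 and 2, which is what makes
    [support_norm] equivalent to the norm. *)
Definition polar_set : set X := [set x | forall u, B u -> `|u x| <= W u].

Definition support_norm (f : X') : R := sup [set `|f x| | x in polar_set].

Lemma unit_dual (f : X') : f != 0 -> B (`|f|^-1 *: f).
Proof.
move=> f0; rewrite /dual_ball/= normrZ ger0_norm ?invr_ge0//.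
by rewrite mulVf ?normr_eq0.
Qed.

Lemma polar_le (f : X') x : polar_set x -> `|f x| <= 2 * `|f|.
Proof.
move=> Ax; have [->|f0] := eqVneq f 0; first by rewrite dual0 !normr0 mulr0.
have := Ax _ (unit_dual f0); rewrite dualZ normrM ger0_norm ?invr_ge0// => h.
rewrite mulrC -ler_pdivrMl ?normr_gt0//; apply: (le_trans h).
by have /andP[] := W12 (`|f|^-1 *: f).
Qed.

Lemma ball_polar x : `|x| <= 1 -> polar_set x.
Proof.
move=> x1 u uB; apply: (le_trans (dual_norm_ub u x1)).
by have /andP[+ _] := W12 u; apply: le_trans.
Qed.

Lemma polarN x : polar_set x -> polar_set (- x).
Proof. by move=> Ax u uB; rewrite dual_appN normrN; exact: Ax. Qed.

Lemma support_has_sup (f : X') : has_sup [set `|f x| | x in polar_set].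
Proof.
split; first by exists `|f 0|, 0 => //; apply: ball_polar; rewrite normr0.
by exists (2 * `|f|) => _ [x Ax <-]; exact: polar_le.
Qed.

Lemma support_ub (f : X') x : polar_set x -> `|f x| <= support_norm f.
Proof. by move=> Ax; apply: ub_le_sup; [case: (support_has_sup f)|exists x]. Qed.

Lemma support_le (f : X') M :
  (forall x, polar_set x -> `|f x| <= M) -> support_norm f <= M.
Proof.
move=> fM; apply: ge_sup; first by case: (support_has_sup f).
by move=> _ [x Ax <-]; exact: fM.
Qed.

Lemma support_ge_norm (f : X') : `|f| <= support_norm f.
Proof. by apply: dual_norm_le => x x1; apply: support_ub; exact: ball_polar. Qed.

Lemma support_le_norm (f : X') : support_norm f <= 2 * `|f|.
Proof. by apply: support_le => x; exact: polar_le. Qed.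

Lemma support_near (f : X') (e : R) : 0 < e ->
  exists2 x, polar_set x & support_norm f - e < f x.
Proof.
move=> e0; have [_ [x Ax <-] fx] := sup_adherent e0 (support_has_sup f).
have [fx0|fx0] := lerP 0 (f x).
  by exists x => //; move: fx; rewrite ger0_norm.
exists (- x); first exact: polarN.
by rewrite dual_appN; move: fx; rewrite ltr0_norm.
Qed.

Lemma support_equivalent : equivalent_norm support_norm.
Proof.
split; last by exists 1, 2; split=> // f; rewrite mul1r support_ge_norm support_le_norm.
have Zle (a : R) f : support_norm (a *: f) <= `|a| * support_norm f.
  apply: support_le => x Ax; rewrite dualZ normrM ler_wpM2l//.
  exact: support_ub.
split=> [f g|a f|f f0].
- apply: support_le => x Ax; rewrite dualD; apply: (le_trans (ler_normD _ _)).
  by apply: lerD; exact: support_ub.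
- apply/eqP; rewrite eq_le Zle/=; have [->|a0] := eqVneq a 0.
    by rewrite normr0 mul0r (le_trans _ (support_ge_norm _)).
  rewrite -ler_pdivlMl ?normr_gt0// -normfV (le_trans _ (Zle _ _))//.
  by rewrite scalerA mulVf// scale1r.
- by apply/eqP; rewrite -normr_le0 -f0 support_ge_norm.
Qed.

(** A finite list of functionals controls the growth of the polar constraints
    under a small perturbation [z]. By weak* compactness [u] is weak* close to
    one of finitely many [u0]; either it is also close in norm, and [z] adds
    to [u x] at most about [eps * tau], or the jump of the weight absorbs the change. *)
Lemma polar_perturb (eps gam tau e : R) (x : X) :
  (forall u0 (e : R), B u0 -> 0 < e -> exists U : set (weak_star X),
    [/\ open U, U u0 & forall u, U u -> B u -> W u0 <= W u + e /\
      (eps < `|u - u0| -> W u0 + gam <= W u + e)]) ->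
  0 <= eps -> 2 * tau <= gam -> polar_set x -> 0 < e ->
  exists us : seq X', forall z, `|z| <= tau ->
    (forall u, u \in us -> `|u z| <= e) ->
    forall u, B u -> `|u (x + z)| <= W u + 3 * e + eps * tau.
Proof.
move=> jump eps0 taugam Ax e0.
have /choice[U HU] : forall u0, exists U : set (weak_star X), B u0 ->
    [/\ open U, U u0 & forall u, U u -> B u -> [/\ `|u x - u0 x| < e,
      W u0 <= W u + e & eps < `|u - u0| -> W u0 + gam <= W u + e]].
  move=> u0; have [u0B|nB] := EM (B u0); last by exists setT.
  have [U [oU Uu0 HU]] := jump u0 e u0B e0.
  have [V [oV Vu0 HV]] := eval_near u0 x e0.
  exists (U `&` V) => _; split=> //; first exact: openI.
  by move=> u [Uu Vu] uB; have [h1 h2] := HU u Uu uB; split=> //; exact: HV.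
have [|s sB sP] := @dual_ball_cover R X U.
  by move=> f fB; have [oU Uf _] := HU f fB.
exists s => z zt sz u uB; have [u0 u0s Uu] := sP u uB; have u0B := sB u0 u0s.
have [_ _ /(_ u Uu uB)[ux Wle Wjump]] := HU u0 u0B.
have u0x := Ax u0 u0B; have u0z := sz u0 u0s.
have uz : `|u z - u0 z| <= `|u - u0| * tau.
  by apply: le_trans (ler_wpM2l _ zt) => //; rewrite -dualB dual_norm_mul.
have tri : `|u (x + z)| <= `|u x - u0 x| + `|u0 x| + `|u0 z| + `|u z - u0 z|.
  have -> : u (x + z) = (u x - u0 x) + u0 x + u0 z + (u z - u0 z).
    by rewrite dual_appD; lra.
  apply: (le_trans (ler_normD _ _)); rewrite lerD2r.
  by apply: (le_trans (ler_normD _ _)); rewrite lerD2r ler_normD.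
have tau0 : 0 <= tau by apply: le_trans zt.
have et : 0 <= eps * tau by rewrite mulr_ge0.
apply: (le_trans tri); have [near|far] := lerP `|u - u0| eps.
  have : `|u - u0| * tau <= eps * tau by rewrite ler_wpM2r.
  by move: Wle; lra.
have : `|u - u0| * tau <= 2 * tau by rewrite ler_wpM2r// dual_ballB2.
by have := Wjump far; lra.
Qed.

End Support.

Section Annihilator.
Context (R : realType) (X : normedModType R).
Local Notation X' := (dual X).

Definition annihilator (xs : seq X) : set X' := [set f | forall x, x \in xs -> f x = 0].

Lemma annihilator_cof xs : cof_wstar (annihilator xs).
Proof.
split.
- split=> [x _|a f g fx gx x xxs]; first exact: dual0.
  by rewrite dualD dualZ fx// gx// mulr0 addr0.
- have -> : (annihilator xs : set (weak_star X)) =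
      \bigcap_(x in [set x | x \in xs]) [set f : weak_star X | (f : X') x = 0].
    by apply/seteqP; split=> f hf x; exact: hf.
  by apply: closed_bigI => x _; exact: closed_eval0.
(* One more functional costs one more dimension, unless it already vanishes on
   the previous annihilator. *)
elim: xs => [|x xs [n [e He]]]; first by exists 0%N, (fun=> 0) => f; exists (fun=> 0).
have [[g [gxs gx]]|ng] := EM (exists g, annihilator xs g /\ g x != 0); last first.
  exists n, e => f; have [a fa] := He f; exists a => y; rewrite in_cons => /orP[/eqP->|].
    by apply/eqP/contraT => fx; case: ng; exists (f - \sum_(i < n) a i *: e i).
  exact: fa.
exists n.+1, (fun i => if unlift ord0 i is Some j then e j else g) => f.
have [a fa] := He f; set h := f - _ in fa.
exists (fun i => if unlift ord0 i is Some j then a j else h x / g x).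
rewrite big_ord_recl unlift_none; under eq_bigr do rewrite liftK.
rewrite opprD addrCA addrC -/h => y; rewrite in_cons => /orP[/eqP->|yxs].
  by rewrite dualB dualZ divfK// subrr.
by rewrite dualB dualZ (fa y yxs) (gxs y yxs) mulr0 subr0.
Qed.

(** The image of a bounded set under finitely many functionals is totally
    bounded: cut its range along one functional at a time into slices of width
    [d]. *)
Lemma finite_net (us : seq X') (d : R) (A : set X) : 0 < d ->
  (forall x, A x -> `|x| <= 1) ->
  exists2 xs : seq X, (forall y, y \in xs -> A y) &
    forall x, A x -> exists2 y, y \in xs & forall u, u \in us -> `|u (x - y)| <= d.
Proof.
move=> d0; elim: us A => [|u us IH] A A1.
  have [[x0 Ax0]|nA] := EM (exists x, A x); last first.
    by exists [::] => // x Ax; case: nA; exists x.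
  by exists [:: x0] => [y|x _]; [rewrite inE => /eqP->|exists x0; rewrite ?inE].
pose t x := Num.truncn ((u x + `|u|) / d).
have /choice[xs xsP] : forall k, exists xs : seq X,
    (forall y, y \in xs -> A y /\ t y = k) /\
    forall x, A x -> t x = k -> exists2 y, y \in xs &
      forall v, v \in us -> `|v (x - y)| <= d.
  move=> k; have [|xs xs1 xs2] := IH [set x | A x /\ t x = k].
    by move=> x [/A1].
  by exists xs; split=> // x Ax tx; exact: xs2.
pose m := Num.truncn ((2 * `|u|) / d).
exists (flatten [seq xs k | k <- iota 0 m.+1]).
  by move=> y /flattenP[_ /mapP[k _ ->] /(xsP k).1[]].
have ux w : A w -> `|u w| <= `|u| by move=> /A1; exact: dual_norm_ub.
move=> x Ax; have := ux x Ax; rewrite ler_norml => /andP[ux1 ux2].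
have [y yx vy] := (xsP (t x)).2 x Ax erefl; have [Ay ty] := (xsP (t x)).1 y yx.
exists y.
  apply/flattenP; exists (xs (t x)) => //; apply/mapP; exists (t x) => //.
  rewrite mem_iota add0n ltnS; apply: le_truncn.
  by rewrite ler_pM2r ?invr_gt0//; lra.
move=> v; rewrite in_cons => /orP[/eqP->{v}|]; last exact: vy.
have t_itv w : A w -> (t w)%:R * d <= u w + `|u| < (t w).+1%:R * d.
  move=> /ux; rewrite ler_norml => /andP[uw _].
  rewrite -ler_pdivlMr// -ltr_pdivrMr//; apply: truncn_itv.
  by rewrite divr_ge0 ?(ltW d0)//; lra.
have := t_itv y Ay; rewrite ty; have := t_itv x Ax; rewrite mulrSr mulrDl mul1r.
move=> /andP[h1 h2] /andP[h3 h4].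
by rewrite dual_appB ler_norml; apply/andP; split; lra.
Qed.

End Annihilator.

Section SzlenkAUC.
Context (R : realType) (X : normedModType R).
Local Notation X' := (dual X).
Local Notation B := (@dual_ball R X).

(** If [xs] is a net of the unit ball for the functionals in [us] and [y] nearly
    attains its norm at [w], subtract from [w] a point of [xs] that [us] cannot
    tell from it: [y] vanishes there, so its value is not affected. Halving the
    difference brings it back to the unit ball. *)
Lemma annihilator_norming (us : seq X') (e : R) : 0 < e ->
  exists xs : seq X, forall y : X', annihilator xs y ->
    exists z, [/\ `|z| <= 1, forall u, u \in us -> `|u z| <= e & `|y| / 4 <= y z].
Proof.
move=> e0; have [xs xs1 xsP] := @finite_net R X us e [set x | `|x| <= 1] e0 (fun _ => id).
exists xs => y yxs; have [w w1 yw] := dual_norm_half y.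
have [p pxs wp] := xsP w w1; exists (2^-1 *: (w - p)); split.
- rewrite normrZ ger0_norm ?invr_ge0// ler_pdivrMl//.
  by have := ler_normB w p; have := xs1 p pxs; rewrite /=; lra.
- move=> u /wp h; rewrite dual_appZ normrM ger0_norm ?invr_ge0//.
  by move: h (normr_ge0 (u (w - p))); lra.
- by rewrite dual_appZ dual_appB (yxs p pxs); lra.
Qed.

(** Let [x] almost norm [f] and [y] annihilate [x] and a suitable finite net. A
    small [z] that norms [y] while [f] and the functionals of [polar_perturb] are
    small on it gives [x + z], which after division by [1 + o(tau)] lies in
    the polar set and shows that the norm of [f + t *: y] exceeds that of [f]. *)
Lemma szlenk_AUCstar : xole (szlenk_index X) (Some omega) ->
  exists N : X' -> R, equivalent_norm N /\ AUCstar N.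
Proof.
move=> Sz; pose W := weight (@szlenk_family R X).
have W12 u : 1 <= W u <= 2 by exact: weight_bounds.
pose N := support_norm W.
exists N; split; first exact: support_equivalent.
(* The functional [t *: y] gains [t * tau / 8 = 4 * th] at [z], while rescaling
   into the polar set loses [eps * tau = th] and errors of size [e]; a gain
   [th] remains. *)
move=> t t0; pose eps := t / 32; have eps0 : 0 < eps by rewrite /eps; lra.
have [gam gam0] := weight_jump Sz eps0; rewrite -/W => jump.
pose tau := Num.min (gam / 2) (Num.min 1 eps^-1).
have ie0 : 0 < eps^-1 by rewrite invr_gt0.
have tau0 : 0 < tau by rewrite /tau !lt_min ie0 ltr01 !andbT; lra.
have taugam : 2 * tau <= gam.
  by have : tau <= gam / 2; [rewrite /tau ge_min lexx|lra].
have tau1 : tau <= 1 by rewrite /tau !ge_min lexx orbT.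
pose th := eps * tau; have th0 : 0 < th by rewrite mulr_gt0.
have th1 : th <= 1.
  by rewrite /th mulrC -ler_pdivlMr// div1r /tau !ge_min lexx !orbT.
pose e := th / 10; have e0 : 0 < e by rewrite /e; lra.
apply: (@lt_le_trans _ _ th%:E); first by rewrite lte_fin.
apply: le_ereal_inf_tmp => _ [f [_ /= f1] <-].
have [x Ax fx] := support_near W12 f e0; rewrite -/(N f) f1 in fx.
have [us usP] := polar_perturb jump (ltW eps0) taugam Ax e0.
have [xs xsP] := annihilator_norming (f :: us) e0.
apply: (le_trans _ (ereal_sup_ubound (imageP _ (annihilator_cof (x :: xs))))).
apply: le_ereal_inf_tmp => _ [y [yY /= y1] <-].
have y2 : 1 / 2 <= `|y| by have := support_le_norm W12 y; rewrite -/(N y) y1; lra.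
have yx : y x = 0 by apply: yY; rewrite mem_head.
have [|z0 [z01 uz0 yz0]] := xsP y.
  by move=> p pxs; apply: yY; rewrite in_cons pxs orbT.
pose z := tau *: z0.
have zt : `|z| <= tau by rewrite normrZ gtr0_norm// ger_pMr.
have uz u : u \in f :: us -> `|u z| <= e.
  move=> /uz0 h; rewrite dual_appZ normrM gtr0_norm//; apply: le_trans h.
  by rewrite ler_piMl.
have yz : tau / 8 <= y z.
  rewrite dual_appZ; apply: (@le_trans _ _ (tau * (`|y| / 4))).
    by rewrite ler_pM2l//; lra.
  by rewrite ler_pM2l.
pose rho := 3 * e + th; have rho0 : 0 < 1 + rho by rewrite /rho; lra.
have Az : polar_set W ((1 + rho)^-1 *: (x + z)).
  move=> u uB; rewrite dual_appZ normrM gtr0_norm ?invr_gt0// ler_pdivrMl//.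
  apply: (le_trans (usP z zt _ u uB)).
    by move=> v vus; apply: uz; rewrite in_cons vus orbT.
  have /andP[W1 _] := W12 u; have : rho * 1 <= rho * W u.
    by rewrite ler_wpM2l// /rho; lra.
  by rewrite -/th; have : rho = 3 * e + th by []; lra.
have Nge : (1 + rho)^-1 * ((f + t *: y) (x + z)) <= N (f + t *: y).
  by rewrite -dual_appZ; apply: le_trans (ler_norm _) (support_ub W12 _ Az).
rewrite lee_fin lerBrDr; apply: le_trans Nge; rewrite ler_pdivlMl//.
have fz : - e <= f z by have := uz f (mem_head _ _); rewrite ler_norml => /andP[].
rewrite dualD dualZ !dual_appD yx add0r.
have tz : 4 * th <= t * y z.
  apply: (@le_trans _ _ (t * (tau / 8))); last by rewrite ler_pM2l.
  by rewrite /th /eps; lra.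
have thth : th * th <= th by rewrite ger_pMr.
have -> : (1 + rho) * (th + 1) = 1 + rho + th + rho * th by lra.
have : rho * th <= 13 / 10 * th by rewrite /rho /e; lra.
by rewrite /rho /e in fx fz *; lra.
Qed.

End SzlenkAUC.

(** * The equivalences *)

Lemma AUCstar_AMUCstar (R : realType) (X : normedModType R) (N : dual X -> R) :
  AUCstar N -> AMUCstar N.
Proof.
move=> aN t t0; apply: (lt_le_trans (aN t t0)).
apply: le_ereal_inf_tmp => _ [x x1 <-].
apply: (le_trans (ereal_inf_lbound (imageP _ x1))).
apply: ge_ereal_sup => _ [Y cY <-].
apply: (le_trans _ (ereal_sup_ubound (imageP _ cY))).
apply: le_ereal_inf_tmp => _ [y yY <-].
apply: (le_trans (ereal_inf_lbound (imageP _ yY))).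
by rewrite lee_fin lerB// le_max lexx.
Qed.

Theorem theoremC (R : realType) (X : completeNormedModType R)
  (sepX : separable_space X) (uncX : wstar_unconditional_structure X) :
  [<-> xole (szlenk_index X) (Some omega);
       exists N : dual X -> R, equivalent_norm N /\ AUCstar N;
       exists N : dual X -> R, equivalent_norm N /\ AMUCstar N;
       ~ property_star X].
Proof.
tfae.
- exact: szlenk_AUCstar.
- by move=> [N [eN /AUCstar_AMUCstar aN]]; exists N.
- by move=> [N [eN aN]]; exact: AMUCstar_no_star aN.
- exact: szlenk_le_omega_of_no_star.
Qed.
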